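(* Let $M\in\mathcal{K}_o^n$ and let $f:S^{n-1}\rightarrow\mathbb{R}$ be continuous. If $Q\in\mathcal{S}_o^n$, $j\neq n$ and $q\neq0$, then $$\lim_{t\rightarrow0}\frac{\widetilde{W}_{q,j}([M,f,t],Q)-\widetilde{W}_{q,j}(M,Q)}{t}=q\int_{S^{n-1}}f(v)\,d\widetilde{\mathcal{C}}_{q,j}(M,Q,v).$$
   Context: $\mathcal{K}_o^n$: convex bodies in $\mathbb{R}^n$ containing the origin in their interiors; $\mathcal{S}_o^n$: compact sets star-shaped about the origin with positive continuous radial function $\rho_Q(x)=\max\{\lambda\ge0:\lambda x\in Q\}$. $h_M$ is the support function, $du$ spherical Lebesgue measure. $[M,f,t]$ denotes a logarithmic family of Wulff shapes generated by $(h_M,f)$: for some $\delta>0$ and $t\in(-\delta,\delta)$, $h_t:S^{n-1}\to(0,\infty)$ is continuous with $\log h_t=\log h_M+tf+o(t,\cdot)$, where $o(t,\cdot)$ is continuous and $o(t,\cdot)/t\to0$ uniformly on $S^{n-1}$ as $t\to0$, and $[M,f,t]=\{x\in\mathbb{R}^n:x\cdot v\le h_t(v)\ \forall v\in S^{n-1}\}$. $\widetilde{W}_{q,j}(M,Q)=\frac1n\int_{S^{n-1}}\rho_M^q\rho_Q^{n-q-j}\,du$; $R^*_M(\eta)=\{u\in S^{n-1}:\rho_M(u)u\cdot v=h_M(v)\text{ for some }v\in\eta\}$ for Borel $\eta\subseteq S^{n-1}$; $\widetilde{\mathcal{C}}_{q,j}(M,Q,\eta)=\frac1n\int_{R^*_M(\eta)}\rho_M^q(u)\rho_Q^{n-q-j}(u)\,du$.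 *)

(* Defs.v *)
(* Points of R^n are n.-tuples of reals (these carry
   the product = Borel sigma-algebra of R^n in MathComp-Analysis). *)
From mathcomp Require Import all_boot all_order all_algebra.
From mathcomp Require Import all_classical all_reals all_analysis.
Import Order.TTheory GRing.Theory Num.Theory.
Import numFieldNormedType.Exports.

Set Implicit Arguments.
Unset Strict Implicit.
Unset Printing Implicit Defensive.

Local Open Scope ring_scope.
Local Open Scope classical_set_scope.

Section Defs.
Context {R : realType} {n : nat}.
Local Notation vec := (n.-tuple R).

Definition vadd (x y : vec) : vec := [tuple tnth x i + tnth y i | i < n].
Definition vscale (a : R) (x : vec) : vec := [tuple a * tnth x i | i < n].
Definition dot (x y : vec) : R := \sum_(i < n) tnth x i * tnth y i.
Definition enorm (x : vec) : R := Num.sqrt (dot x x).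
Definition sphere : set vec := [set u | enorm u = 1].
Definition normalize (x : vec) : vec := vscale (enorm x)^-1 x.

Definition cont_on_sphere (g : vec -> R) : Prop :=
  forall u, sphere u -> forall e : R, 0 < e -> exists2 d : R, 0 < d &
    forall w, sphere w -> enorm (vadd u (vscale (-1) w)) < d ->
      `|g u - g w| < e.

Definition closed_set (K : set vec) : Prop :=
  forall x, (forall e : R, 0 < e -> exists2 y, K y & enorm (vadd x (vscale (-1) y)) < e) -> K x.
Definition bounded_set (K : set vec) : Prop :=
  exists r : R, forall x, K x -> enorm x <= r.
Definition compact_set (K : set vec) : Prop := closed_set K /\ bounded_set K.
Definition origin_interior (K : set vec) : Prop :=
  exists2 r : R, 0 < r & forall x, enorm x < r -> K x.
Definition convex_set (K : set vec) : Prop :=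
  forall x y, K x -> K y -> forall t : R, 0 <= t <= 1 ->
    K (vadd (vscale t x) (vscale (1 - t) y)).

Definition supp_fun (K : set vec) (v : vec) : R := sup [set dot x v | x in K].
Definition radial (K : set vec) (x : vec) : R :=
  sup [set l : R | 0 <= l /\ K (vscale l x)].

Definition convex_body_o (K : set vec) : Prop :=
  [/\ convex_set K, compact_set K & origin_interior K].

Definition star_shaped_o (K : set vec) : Prop :=
  forall x, K x -> forall t : R, 0 <= t <= 1 -> K (vscale t x).
Definition star_body_o (K : set vec) : Prop :=
  [/\ compact_set K, star_shaped_o K,
      (forall u, sphere u -> 0 < radial K u) & cont_on_sphere (radial K)].

Definition wulff (h : R -> vec -> R) (t : R) : set vec :=
  [set x | forall v, sphere v -> dot x v <= h t v].

Definition log_wulff_family (M : set vec) (f : vec -> R) (h : R -> vec -> R)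
    (delta : R) : Prop :=
  0 < delta /\
  exists o : R -> vec -> R,
    [/\ (forall t, `|t| < delta ->
           [/\ forall v, sphere v -> 0 < h t v,
               cont_on_sphere (h t),
               cont_on_sphere (o t) &
               forall v, sphere v ->
                 ln (h t v) = ln (supp_fun M v) + t * f v + o t v]) &
        forall e : R, 0 < e -> exists2 d : R, 0 < d &
          forall t, 0 < `|t| < d -> forall v, sphere v -> `|o t v / t| <= e].

Local Open Scope ereal_scope.

Definition lebesgue_tuple (lam : {measure set vec -> \bar R}) : Prop :=
  forall a b : vec, (forall i, (tnth a i <= tnth b i)%R) ->
    lam [set x | forall i, (tnth a i < tnth x i <= tnth b i)%R] =
    (\prod_(i < n) (tnth b i - tnth a i))%:E.

(* integral over D (subset of S^{n-1}) w.r.t. the spherical Lebesgue measure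
   du, written via the cone over D:
   int_D g du = n * int_{ {x : 0<|x|<=1, x/|x| in D} } g(x/|x|) dx *)
Definition sph_int (lam : {measure set vec -> \bar R}) (D : set vec)
    (g : vec -> R) : \bar R :=
  (n%:R)%:E * \int[lam]_(x in [set x | (0 < enorm x <= 1)%R /\ D (normalize x)])
                 (g (normalize x))%:E.

Definition Wtilde (lam : {measure set vec -> \bar R}) (q j : R)
    (K Q : set vec) : R :=
  fine ((n%:R)^-1%:E * sph_int lam sphere
          (fun u => radial K u `^ q * radial Q u `^ (n%:R - q - j))%R).

Definition Rstar (K : set vec) (eta : set vec) : set vec :=
  [set u | sphere u /\ exists2 v, eta v &
     dot (vscale (radial K u) u) v = supp_fun K v].

Definition Ctilde (lam : {measure set vec -> \bar R}) (q j : R)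
    (K Q : set vec) (eta : set vec) : \bar R :=
  (n%:R)^-1%:E * sph_int lam (Rstar K eta)
          (fun u => radial K u `^ q * radial Q u `^ (n%:R - q - j))%R.

End Defs.

(* Main.v *)
(* For a unit vector u let A(u) be the set of directions v touching M at the boundary
   point in direction u, i.e. rho_M(u) (u.v) = h_M(v). The logarithm of the radial
   function of a Wulff shape is the minimum over v of ln h(v) - ln (u.v), so by Danskin's
   argument ln rho_{[M,f,t]}(u) is differentiable at t = 0, with derivative the value of f
   on A(u), whenever f is constant on A(u); its increments are O(t) uniformly in u.
   Dominated convergence then gives the derivative of the dual mixed volume as an integral
   of this value against rho_M^q rho_Q^(n-q-j) du.

   That f is constant on A(u) for almost every u follows from the additivity of the
   curvature measure: for a < b the sets {f <= a} and {f >= b} are disjoint, so the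
   directions u whose A(u) meets both carry no mass. Off the union of these null sets over
   rational a < b, membership of u in R*_M({f in B}) just says that the value of f on A(u)
   is in B, which turns the integral above into the integral of f against the measure. *)
Require Import Defs.
From mathcomp Require Import all_boot all_order all_algebra.
From mathcomp Require Import all_classical all_reals all_analysis.
From mathcomp Require Import measurable_realfun.
From mathcomp Require Import ring lra.
Import Order.TTheory GRing.Theory Num.Theory.
Import numFieldNormedType.Exports.
Local Open Scope ring_scope.
Local Open Scope classical_set_scope.

Set Implicit Arguments.
Unset Strict Implicit.
Unset Printing Implicit Defensive.

Section Vectors.
Context {R : realType} {n : nat}.
Implicit Types (x y z u v w : n.-tuple R) (a b e : R).

Definition vsub x y := vadd x (vscale (-1) y).

Lemma dotC x y : dot x y = dot y x.
Proof. by apply: eq_bigr => i _; rewrite mulrC. Qed.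

Lemma dotDl x y z : dot (vadd x y) z = dot x z + dot y z.
Proof.
by rewrite -big_split; apply: eq_bigr => i _ /=; rewrite tnth_mktuple mulrDl.
Qed.

Lemma dotZl a x z : dot (vscale a x) z = a * dot x z.
Proof.
by rewrite mulr_sumr; apply: eq_bigr => i _ /=; rewrite tnth_mktuple mulrA.
Qed.

Lemma dotDr x y z : dot z (vadd x y) = dot z x + dot z y.
Proof. by rewrite dotC dotDl !(dotC z). Qed.

Lemma dotZr a x z : dot z (vscale a x) = a * dot z x.
Proof. by rewrite dotC dotZl dotC. Qed.

Lemma dotBl x y z : dot (vsub x y) z = dot x z - dot y z.
Proof. by rewrite dotDl dotZl mulN1r. Qed.

Lemma dotBr x y z : dot z (vsub x y) = dot z x - dot z y.
Proof. by rewrite dotC dotBl !(dotC z). Qed.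

Lemma dot_ge0 x : 0 <= dot x x.
Proof. by apply: sumr_ge0 => i _; rewrite -expr2 sqr_ge0. Qed.

Lemma enorm_ge0 x : 0 <= enorm x.
Proof. exact: sqrtr_ge0. Qed.

Lemma sqr_enorm x : enorm x ^+ 2 = dot x x.
Proof. by rewrite sqr_sqrtr// dot_ge0. Qed.

Lemma sphere_dot u : sphere u -> dot u u = 1.
Proof. by rewrite -sqr_enorm => ->; rewrite expr1n. Qed.

Lemma enorm_eq0 x : enorm x = 0 -> forall i, tnth x i = 0.
Proof.
move=> x0 i; have : dot x x == 0 by rewrite -sqr_enorm x0 expr0n.
rewrite psumr_eq0; last by move=> j _; rewrite -expr2 sqr_ge0.
by move/allP => /(_ i); rewrite mem_index_enum mulf_eq0 orbb => /(_ isT)/eqP.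
Qed.

Lemma cauchy_schwarz x y : dot x y <= enorm x * enorm y.
Proof.
have [x0|xN0] := eqVneq (enorm x) 0.
  rewrite /dot big1 ?mulr_ge0 ?enorm_ge0// => i _.
  by rewrite (enorm_eq0 x0) mul0r.
have [y0|yN0] := eqVneq (enorm y) 0.
  rewrite /dot big1 ?mulr_ge0 ?enorm_ge0// => i _.
  by rewrite (enorm_eq0 y0) mulr0.
have xp : 0 < enorm x by rewrite lt_def xN0 enorm_ge0.
have yp : 0 < enorm y by rewrite lt_def yN0 enorm_ge0.
have := dot_ge0 (vsub (vscale (enorm y) x) (vscale (enorm x) y)).
rewrite !(dotBl, dotBr, dotZl, dotZr) (dotC y x) -!sqr_enorm => h.
have xyp := mulr_gt0 xp yp.
rewrite -(ler_pM2l xyp); nra.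
Qed.

Lemma enormZ a x : enorm (vscale a x) = `|a| * enorm x.
Proof.
by rewrite /enorm dotZl dotZr mulrA -expr2 sqrtrM ?sqr_ge0// sqrtr_sqr.
Qed.

Lemma ler_enormD x y : enorm (vadd x y) <= enorm x + enorm y.
Proof.
have xy0 := addr_ge0 (enorm_ge0 x) (enorm_ge0 y).
rewrite -(ler_pXn2r (n := 2)) ?nnegrE ?enorm_ge0// sqr_enorm.
rewrite !(dotDl, dotDr) (dotC y x) -!sqr_enorm.
have := cauchy_schwarz x y; nra.
Qed.

Lemma enorm_vsubC x y : enorm (vsub x y) = enorm (vsub y x).
Proof. by rewrite /enorm !(dotBl, dotBr) (dotC y x); congr Num.sqrt; ring. Qed.

Lemma enorm_vsub_triangle y x z :
  enorm (vsub x z) <= enorm (vsub x y) + enorm (vsub y z).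
Proof.
rewrite (_ : vsub x z = vadd (vsub x y) (vsub y z)) ?ler_enormD//.
by apply: eq_from_tnth => i; rewrite !tnth_mktuple; ring.
Qed.

Lemma ler_dist_enorm x y : `|enorm x - enorm y| <= enorm (vsub x y).
Proof.
have tri u v : enorm u - enorm v <= enorm (vsub u v).
  rewrite lerBlDr; apply: le_trans (ler_enormD _ _).
  rewrite le_eqVlt (_ : vadd _ _ = u) ?eqxx//.
  by apply: eq_from_tnth => i; rewrite !tnth_mktuple; ring.
by rewrite ler_norml tri andbT lerNl opprB enorm_vsubC tri.
Qed.

Lemma normr_dot_le x y : `|dot x y| <= enorm x * enorm y.
Proof.
rewrite ler_norml cauchy_schwarz andbT lerNl -mulN1r -dotZl.
by apply: le_trans (cauchy_schwarz _ _) _; rewrite enormZ normrN1 mul1r.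
Qed.

Lemma dot_vsub_le x u w : dot x u - dot x w <= enorm x * enorm (vsub u w).
Proof. by rewrite -dotBr cauchy_schwarz. Qed.

Lemma dot_sphere_le1 u v : sphere u -> sphere v -> dot u v <= 1.
Proof.
by move=> su sv; apply: le_trans (cauchy_schwarz _ _) _; rewrite su sv mulr1.
Qed.

Lemma vscale1 x : vscale 1 x = x.
Proof. by apply: eq_from_tnth => i; rewrite tnth_mktuple mul1r. Qed.

Lemma vscaleA a b x : vscale a (vscale b x) = vscale (a * b) x.
Proof. by apply: eq_from_tnth => i; rewrite !tnth_mktuple mulrA. Qed.

Lemma sphere_normalize x : 0 < enorm x -> sphere (normalize x).
Proof.
move=> x0; rewrite /sphere/= /normalize enormZ ger0_norm ?invr_ge0 ?enorm_ge0//.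
by rewrite mulVf// gt_eqF.
Qed.

Lemma normalizeK x : 0 < enorm x -> vscale (enorm x) (normalize x) = x.
Proof. by move=> x0; rewrite vscaleA mulfV ?gt_eqF// vscale1. Qed.

Lemma enorm_le_coord x e : 0 <= e -> (forall i, `|tnth x i| <= e) ->
  enorm x <= e * n%:R.
Proof.
move=> e0 xe.
rewrite -(ler_pXn2r (n := 2)) ?nnegrE ?enorm_ge0 ?mulr_ge0//.
rewrite sqr_enorm; apply: (@le_trans _ _ (\sum_(i < n) e ^+ 2)).
  by apply: ler_sum => i _; rewrite -expr2 -(real_normK (num_real _)) lerXn2r ?nnegrE.
rewrite sumr_const card_ord -[X in X <= _]mulr_natr exprMn ler_wpM2l ?sqr_ge0//.
by rewrite -natrX ler_nat; case: (n) => // m; rewrite expnS leq_pmulr// expn_gt0.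
Qed.

Lemma coord_le_enorm x i : `|tnth x i| <= enorm x.
Proof.
rewrite -(ler_pXn2r (n := 2)) ?nnegrE ?enorm_ge0// sqr_enorm real_normK ?num_real//.
by rewrite /dot (bigD1 i)//= -expr2 lerDl sumr_ge0// => j _; rewrite -expr2 sqr_ge0.
Qed.

End Vectors.

Section Sphere_continuity.
Context {R : realType} {n : nat}.
Implicit Types (u v w : n.-tuple R) (g : n.-tuple R -> R).

Definition sphere_nbhs u : set_system (n.-tuple R) :=
  [set B | exists2 d : R, 0 < d &
     forall w, sphere w -> enorm (vsub u w) < d -> B w].

#[global] Instance sphere_nbhs_filter u : Filter (sphere_nbhs u).
Proof.
split.
- by exists 1.
- move=> B C [d d0 Bd] [e e0 Ce]; exists (Num.min d e).
    by rewrite lt_min d0 e0.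
  by move=> w sw; rewrite lt_min => /andP[wd we]; split; [exact: Bd|exact: Ce].
- by move=> B C BC [d d0 Bd]; exists d => // w sw /(Bd _ sw)/BC.
Qed.

Lemma cont_on_sphereP g :
  cont_on_sphere g <-> forall u, sphere u -> g w @[w --> sphere_nbhs u] --> g u.
Proof.
split=> [cg u su|cg u su e e0].
  by apply/cvgrPdist_lt => e e0; have [d d0 gd] := cg u su e e0; exists d.
by have /cvgrPdist_lt/(_ e e0)[d d0 gd] := cg u su; exists d.
Qed.

Lemma lipschitz_cont_on_sphere g (L : R) :
  (forall u w, sphere u -> sphere w -> g u - g w <= L * enorm (vsub u w)) ->
  cont_on_sphere g.
Proof.
move=> gL u su e e0; exists (e / (`|L| + 1)).
  by rewrite divr_gt0// ltr_wpDl.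
move=> w sw uw.
have L1 : 0 < `|L| + 1 by rewrite ltr_wpDl.
have h a b : sphere a -> sphere b -> enorm (vsub a b) < e / (`|L| + 1) ->
    g a - g b < e.
  move=> sa sb; rewrite ltr_pdivlMr// => ab; apply: le_lt_trans (gL a b sa sb) _.
  apply: le_lt_trans ab; rewrite mulrC ler_wpM2l ?enorm_ge0//.
  by apply: le_trans (ler_norm _) _; rewrite lerDl.
by rewrite ltr_norml h// andbT ltrNl opprB h// enorm_vsubC.
Qed.

Lemma cont_on_sphere_comp (p : R -> R) g :
  (forall u, sphere u -> {for g u, continuous p}) -> cont_on_sphere g ->
  cont_on_sphere (p \o g).
Proof.
move=> cp /cont_on_sphereP cg; apply/cont_on_sphereP => u su.
by apply: continuous_cvg; [exact: cp|exact: cg].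
Qed.

Lemma cont_on_sphere_eq g g' : (forall u, sphere u -> g u = g' u) ->
  cont_on_sphere g -> cont_on_sphere g'.
Proof.
move=> gg' cg u su e e0; have [d d0 gd] := cg u su e e0; exists d => // w sw.
by rewrite -!gg'//; exact: gd.
Qed.

Lemma cont_on_sphere_powR g (q : R) : (forall u, sphere u -> 0 < g u) ->
  cont_on_sphere g -> cont_on_sphere (fun u => g u `^ q).
Proof.
move=> g0 /cont_on_sphereP cg.
apply: (@cont_on_sphere_eq (fun u => expR (q * ln (g u)))) => [u su|].
  by rewrite /powR gt_eqF// g0.
apply/cont_on_sphereP => u su; apply: continuous_cvg; first exact: continuous_expR.
apply: cvgMr; apply: continuous_cvg; last exact: cg.
by apply: continuous_ln; exact: g0.
Qed.

(* Bolzano-Weierstrass on the sphere, through the product topology of row vectors. *)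
Lemma sphere_cluster (v_ : nat -> n.-tuple R) : (forall k, sphere (v_ k)) ->
  exists2 u, sphere u & forall (e : R) N, 0 < e ->
    exists2 k, (N <= k)%N & enorm (vsub u (v_ k)) < e.
Proof.
move=> sv.
pose r_ k : 'rV[R]_n := \row_i tnth (v_ k) i.
have := @rV_compact R n (fun=> `[-1, 1]) (fun=> @segment_compact _ _ _).
move=> /(_ (r_ @ \oo) _) [].
  exists 0%N => // k _ i /=; rewrite in_itv/= mxE -ler_norml.
  by rewrite -(sv k); exact: coord_le_enorm.
move=> p [_ clp].
have key (e : R) N : 0 < e ->
    exists2 k, (N <= k)%N & enorm (vsub [tuple p ord0 i | i < n] (v_ k)) < e.
  move=> e0; pose e' := e / (n%:R + 1).
  have n1 : 0 < n%:R + 1 :> R by rewrite ltr_wpDl.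
  have e'0 : 0 < e' by rewrite divr_gt0.
  have [] := clp [set r_ k | k in [set k | (N <= k)%N]] (ball p e').
  - by exists N => // k Nk; exists k.
  - exact: nbhsx_ballx.
  move=> _ [[k Nk <-] kp]; exists k => //.
  have : enorm (vsub [tuple p ord0 i | i < n] (v_ k)) <= e' * n%:R.
    apply: enorm_le_coord; first exact: ltW.
    move=> i; rewrite !tnth_mktuple mulN1r.
    by have := kp.2 ord0 i; rewrite /ball/= mxE => /ltW.
  move=> /le_lt_trans; apply.
  by rewrite -mulrA gtr_pMr// mulrC ltr_pdivrMr// mul1r ltrDl.
exists [tuple p ord0 i | i < n] => //.
apply/eqP; rewrite -subr_eq0 -normr_le0; apply/ler_addgt0Pr => e e0; rewrite add0r.
have [k _ /ltW kp] := key e 0%N e0.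
by rewrite -(sv k); apply: le_trans kp; exact: ler_dist_enorm.
Qed.

Lemma normrD_self_ge0 (y : R) : 0 <= `|y| + y.
Proof. by rewrite -lerBlDr sub0r -normrN ler_norm. Qed.

Lemma cont_on_sphere_min g : cont_on_sphere g ->
  (forall v, sphere v -> 0 < g v) ->
  exists2 m : R, 0 < m & forall v, sphere v -> m <= g v.
Proof.
move=> cg g0; apply: contrapT => nm.
have /choice[v_ v_P] : forall k : nat, exists v, sphere v /\ g v < k.+1%:R^-1.
  move=> k; apply: contrapT => nv; apply: nm; exists k.+1%:R^-1 => // v sv.
  by rewrite leNgt; apply/negP => gv; apply: nv; exists v.
have [u su clu] := sphere_cluster (fun k => (v_P k).1).
have gu := g0 u su.
have gu2 : 0 < g u / 2 by rewrite divr_gt0.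
have [d d0 gd] := cg u su (g u / 2) gu2.
have [N /ltW Ng] : exists N, (N.+1%:R^-1 : R) < g u / 2.
  have [N _ /(_ N)] := near_infty_natSinv_lt (PosNum gu2).
  by move=> /(_ (leqnn _)) h; exists N.
have [k Nk kd] := clu d N d0.
have := gd _ (v_P k).1 kd.
have kN : (k.+1%:R^-1 : R) <= N.+1%:R^-1.
  by rewrite lef_pV2 ?posrE// ler_nat.
rewrite ltr_norml => /andP[_].
have /ltW vk := (v_P k).2.
have {Ng} := le_trans kN Ng => /(le_trans vk) gvk.
by move: gvk; set a := g (v_ k); set b := g u; lra.
Qed.

Lemma cont_on_sphere_bounded g : cont_on_sphere g ->
  exists2 B : R, 0 < B & forall v, sphere v -> `|g v| <= B.
Proof.
move=> cg.
have c1 : cont_on_sphere (fun v => (1 + `|g v|)^-1).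
  move/cont_on_sphereP in cg; apply/cont_on_sphereP => u su.
  apply: cvgV; first by rewrite gt_eqF// ltr_wpDr.
  by apply: cvgD; [exact: cvg_cst|apply: cvg_norm; exact: cg].
have [v _|m m0 mg] := cont_on_sphere_min c1.
  by rewrite invr_gt0 ltr_wpDr.
exists m^-1; first by rewrite invr_gt0.
move=> v /mg; rewrite -lef_pV2 ?posrE ?invr_gt0 ?ltr_wpDr// invrK.
by apply: le_trans; rewrite lerDr.
Qed.

End Sphere_continuity.

Section Convex_bodies.
Context {R : realType} {n : nat}.
Implicit Types (u v w x y : n.-tuple R) (K M : set (n.-tuple R)).

Lemma supp_fun_has_sup M v : convex_body_o M ->
  has_sup [set dot x v | x in M].
Proof.
move=> [_ [_ [r Mr]] [r0 r00 Mr0]]; split.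
  exists (dot (vscale 0 v) v); exists (vscale 0 v) => //.
  by apply: Mr0; rewrite enormZ normr0 mul0r.
exists (r * enorm v) => _ [x Mx <-]; apply: le_trans (cauchy_schwarz _ _) _.
by rewrite ler_wpM2r ?enorm_ge0 ?Mr.
Qed.

Lemma dot_le_supp_fun M x v : convex_body_o M -> M x -> dot x v <= supp_fun M v.
Proof.
move=> cM Mx; apply: ub_le_sup; last by exists x.
by have [] := supp_fun_has_sup v cM.
Qed.

Lemma supp_fun_gt0 M v : convex_body_o M -> sphere v -> 0 < supp_fun M v.
Proof.
move=> cM sv; have [_ _ [r r0 Mr]] := cM.
have r2 : 0 < r / 2 by rewrite divr_gt0.
apply: lt_le_trans r2 _.
have -> : r / 2 = dot (vscale (r / 2) v) v by rewrite dotZl sphere_dot ?mulr1.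
apply: dot_le_supp_fun => //; apply: Mr.
by rewrite enormZ sv mulr1 gtr0_norm//; lra.
Qed.

Lemma cont_on_sphere_supp_fun M : convex_body_o M -> cont_on_sphere (supp_fun M).
Proof.
move=> cM; have [_ [_ [r Mr]] _] := cM.
apply: (@lipschitz_cont_on_sphere _ _ _ r) => u w su sw.
rewrite lerBlDr; apply: ge_sup; first by have [] := supp_fun_has_sup u cM.
move=> _ [x Mx <-]; rewrite -lerBlDr.
have := dot_vsub_le x u w; have := dot_le_supp_fun w cM Mx.
have : enorm x * enorm (vsub u w) <= r * enorm (vsub u w).
  by rewrite ler_wpM2r ?enorm_ge0 ?Mr.
lra.
Qed.

(* A point off [M] is separated from [M] by the direction from an almost nearest
   point [y] of [M]: moving from [y] towards any [z] in [M] cannot decrease the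
   squared distance by more than [e]. *)
Lemma convex_body_eq_wulff M : convex_body_o M ->
  M = [set x | forall v, sphere v -> dot x v <= supp_fun M v].
Proof.
move=> cM; have [convM [clM [r Mr]] [r0 r00 Mr0]] := cM.
apply/seteqP; split=> [x Mx v _|x xh /=]; first exact: dot_le_supp_fun.
apply: clM => d d0; apply: contrapT => nd.
have {}nd y : M y -> d <= enorm (vsub x y).
  by move=> My; rewrite leNgt; apply/negP => xy; apply: nd; exists y.
pose D := [set dot (vsub x y) (vsub x y) | y in M].
have M0 : M (vscale 0 x) by apply: Mr0; rewrite enormZ normr0 mul0r.
have Dinf : has_inf D.
  split; first by exists (dot (vsub x (vscale 0 x)) (vsub x (vscale 0 x))); exists (vscale 0 x).
  by exists 0 => _ [y _ <-]; exact: dot_ge0.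
pose s := Num.min 1 (d ^+ 2 / (4 * (2 * r) ^+ 2 + 4)).
have P0 : 0 < 4 * (2 * r) ^+ 2 + 4 by rewrite ltr_wpDl// mulr_ge0// sqr_ge0.
have s0 : 0 < s by rewrite lt_min ltr01 divr_gt0// exprn_gt0.
have s1 : s <= 1 by rewrite ge_min lexx.
have sd : s * (4 * (2 * r) ^+ 2 + 4) <= d ^+ 2.
  by rewrite -ler_pdivlMr// ge_min lexx orbT.
have e0 : 0 < s * (d ^+ 2 / 2) by rewrite mulr_gt0// divr_gt0// exprn_gt0.
have [_ [y My <-] Dy] := inf_adherent e0 Dinf.
have xy := nd y My.
pose c := enorm (vsub x y).
have c0 : 0 < c by exact: lt_le_trans xy.
have sn : sphere (normalize (vsub x y)) by exact: sphere_normalize.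
have := xh _ sn; rewrite leNgt => /negP; apply.
suff H z : M z -> c * dot z (normalize (vsub x y)) <=
    c * dot x (normalize (vsub x y)) - d ^+ 2 / 4.
  rewrite -(ltr_pM2l c0).
  apply: (@le_lt_trans _ _ (c * dot x (normalize (vsub x y)) - d ^+ 2 / 4)).
    rewrite mulrC -ler_pdivlMr//; apply: ge_sup.
      by have [] := supp_fun_has_sup (normalize (vsub x y)) cM.
    by move=> _ [z Mz <-]; rewrite ler_pdivlMr// mulrC H.
  by rewrite ltrBlDr ltrDl divr_gt0// exprn_gt0.
move=> Mz; rewrite -!dotZr normalizeK//.
have Mw : M (vadd (vscale s z) (vscale (1 - s) y)).
  by apply: convM => //; rewrite (ltW s0).
have := lt_le_trans Dy (lerD (ge_inf Dinf.2 (ex_intro2 _ _ _ Mw erefl)) (lexx _)).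
have zy : dot (vsub z y) (vsub z y) <= (2 * r) ^+ 2.
  rewrite -sqr_enorm lerXn2r ?nnegrE ?enorm_ge0//.
    by rewrite mulr_ge0// (le_trans (enorm_ge0 _) (Mr _ My)).
  apply: le_trans (ler_enormD _ _) _.
  by rewrite enormZ normrN1 mul1r mulr_natl mulr2n lerD ?Mr.
have cc : d ^+ 2 <= dot (vsub x y) (vsub x y).
  by rewrite -sqr_enorm lerXn2r ?nnegrE ?enorm_ge0// ltW.
have := conj zy cc; rewrite !(dotBl, dotBr, dotDl, dotDr, dotZl, dotZr).
rewrite !(dotC y x) !(dotC z x) !(dotC z y).
set xx := dot x x; set yy := dot y y; set zz := dot z z.
set x1 := dot x y; set x2 := dot x z; set x3 := dot y z.
set rr := (2 * r) ^+ 2 in sd *; set dd := d ^+ 2 in sd *.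
move=> [zy' cc'] Dyy.
have {Dyy} : 0 < s * (dd / 2 - 2 * (x2 - x1 - x3 + yy) + s * (zz - x3 - (x3 - yy))).
  by move: Dyy; rewrite -subr_gt0; congr (0 < _); ring.
rewrite pmulr_rgt0// => h.
have aux (a b : R) : 0 < dd / 2 - 2 * (x2 - x1 - x3 + yy) + a ->
    4 * b + 4 * s <= dd -> a <= b -> x2 - x3 <= xx - x1 - dd / 4.
  by move: s0 cc' (sqr_ge0 d) => {sd}; rewrite -/dd; clearbody s x1 x2 x3 xx yy dd; lra.
have : s * (zz - x3 - (x3 - yy)) <= s * rr by rewrite ler_wpM2l// ltW.
have : 4 * (s * rr) + 4 * s <= dd by apply: le_trans sd; rewrite mulrDr mulrCA (mulrC 4 s).
exact: aux.
Qed.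

Definition wulff_contact (h : n.-tuple R -> R) u (r : R) :=
  [/\ 0 < r, forall v, sphere v -> r * dot u v <= h v &
      exists2 v, sphere v & r * dot u v = h v].

Lemma radial_wulff_contact (h : n.-tuple R -> R) K u :
  cont_on_sphere h -> (forall v, sphere v -> 0 < h v) ->
  K = [set x | forall v, sphere v -> dot x v <= h v] -> sphere u ->
  wulff_contact h u (radial K u).
Proof.
move=> ch h0 -> su; set K' := [set x | _].
set A := [set l : R | 0 <= l /\ K' (vscale l u)].
have [m m0 mh] := cont_on_sphere_min ch h0.
have Am : A m.
  split; first exact: ltW.
  move=> v sv; rewrite dotZl; apply: le_trans (mh v sv).
  by rewrite ler_piMr ?(ltW m0) ?dot_sphere_le1.
have Aub : ubound A (h u).
  by move=> l [_ /(_ u su)]; rewrite dotZl sphere_dot// mulr1.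
have hsA : has_sup A by split; [exists m|exists (h u)].
have r0 : 0 < radial K' u by apply: lt_le_trans m0 _; apply: ub_le_sup => //; exists (h u).
have rle v : sphere v -> radial K' u * dot u v <= h v.
  move=> sv; have [uv|uv] := leP (dot u v) 0.
    apply: le_trans (ltW (h0 v sv)).
    by rewrite pmulr_rle0.
  rewrite -ler_pdivlMr//; apply: ge_sup; first by exists m.
  by move=> l [_ /(_ v sv)]; rewrite dotZl ler_pdivlMr.
split=> //; apply: contrapT => nv.
have [||e e0 he] := @cont_on_sphere_min _ _ (fun v => h v - radial K' u * dot u v).
- apply/cont_on_sphereP => v sv; move/cont_on_sphereP in ch.
  apply: cvgB; first exact: ch.
  apply: cvgMr; apply/cvgrPdist_lt => e e0; exists e => // w sw vw.
  by apply: le_lt_trans vw; rewrite -dotBr (le_trans (normr_dot_le _ _))// su mul1r.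
- move=> v sv; rewrite subr_gt0 lt_neqAle rle// andbT.
  by apply/eqP => hv; apply: nv; exists v.
have Are : A (radial K' u + e).
  split; first by rewrite addr_ge0// ltW.
  move=> v sv; rewrite dotZl mulrDl.
  have := he v sv; have : e * dot u v <= e by rewrite ler_piMr ?(ltW e0) ?dot_sphere_le1.
  lra.
have : radial K' u + e <= radial K' u by apply: ub_le_sup => //; exists (h u).
by rewrite gerDl leNgt e0.
Qed.

Lemma cont_on_sphere_radial (h : n.-tuple R -> R) K :
  cont_on_sphere h -> (forall v, sphere v -> 0 < h v) ->
  K = [set x | forall v, sphere v -> dot x v <= h v] ->
  cont_on_sphere (radial K).
Proof.
move=> ch h0 Kh.
have [m m0 mh] := cont_on_sphere_min ch h0.
have wc u := @radial_wulff_contact h K u ch h0 Kh.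
have : cont_on_sphere (fun u => (radial K u)^-1).
  apply: (@lipschitz_cont_on_sphere _ _ _ m^-1) => u w su sw.
  have [ru _ [v sv uv]] := wc u su; have [rw + _] := wc w sw.
  move=> /(_ v sv) wv.
  have hv := h0 v sv.
  have -> : (radial K u)^-1 = dot u v / h v.
    by rewrite -uv invfM mulrCA mulfV ?mulr1// gt_eqF// -(pmulr_rgt0 _ ru) uv.
  have {}wv : dot w v / h v <= (radial K w)^-1.
    by rewrite ler_pdivrMr// mulrC ler_pdivlMr// mulrC.
  apply: le_trans (lerB (lexx _) wv) _.
  rewrite -mulrBl -dotBl mulrC.
  apply: (@le_trans _ _ ((h v)^-1 * enorm (vsub u w))).
    rewrite ler_wpM2l ?invr_ge0 ?(ltW hv)//.
    by apply: le_trans (cauchy_schwarz _ _) _; rewrite sv mulr1.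
  by rewrite ler_wpM2r ?enorm_ge0// lef_pV2 ?posrE ?mh.
move=> H0; have H := @cont_on_sphere_comp R n (@GRing.inv R) _ _ H0.
apply: cont_on_sphere_eq (H _) => [u _ /=|u su]; first by rewrite invrK.
by apply: inv_continuous; have [r0 _ _] := wc u su; rewrite gt_eqF// invr_gt0.
Qed.

Lemma ln_radial_le (h h' : n.-tuple R -> R) u v (r r' : R) : 0 < r ->
  sphere v -> 0 < h v -> 0 < h' v ->
  wulff_contact h' u r' -> r * dot u v = h v ->
  ln r' - ln r <= ln (h' v) - ln (h v).
Proof.
move=> r0 sv hv h'v [r'0 r'h _] ruv.
have uv0 : 0 < dot u v by rewrite -(pmulr_rgt0 _ r0) ruv.
have := r'h v sv; rewrite -ler_ln ?posrE ?mulr_gt0// lnM ?posrE//.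
by rewrite -ruv lnM ?posrE//; lra.
Qed.

End Convex_bodies.

Section Variation.
Context {R : realType} {n : nat}.
Implicit Types (u v w x y : n.-tuple R) (M : set (n.-tuple R)).

Lemma expR_sub1_taylor (x : R) : `|x| <= 1 / 2 -> `|expR x - 1 - x| <= 2 * x ^+ 2.
Proof.
move=> x2.
have xl : - (1 / 2) <= x <= 1 / 2 by rewrite -ler_norml.
have h1 := expR_ge1Dx x; have h2 := expR_ge1Dx (- x).
have e0 := expR_gt0 x.
have : expR x * (1 - x) <= 1.
  apply: le_trans (_ : expR x * expR (- x) <= 1); first by rewrite ler_pM2l.
  by rewrite -expRD subrr expR0.
move=> h3; rewrite ger0_norm; last by rewrite subr_ge0 lerBrDl.
move/andP: xl => [xl xu]; have x10 : 0 < 1 - x by lra.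
rewrite -!addrA -opprD lerBlDr -(ler_pM2r x10); apply: le_trans h3 _.
rewrite -subr_ge0 (_ : _ - 1 = x ^+ 2 * (1 - 2 * x)); last by ring.
by rewrite mulr_ge0 ?sqr_ge0//; lra.
Qed.

Lemma expR_sub1_le (x : R) : `|x| <= 1 / 2 -> `|expR x - 1| <= 2 * `|x|.
Proof.
move=> x2; have h := expR_sub1_taylor x2.
rewrite -[X in `|X|](subrK x); apply: le_trans (ler_normD _ _) _.
rewrite -(real_normK (num_real x)) in h.
have : 0 <= `|x| * (1 / 2 - `|x|) by rewrite mulr_ge0 ?subr_ge0.
rewrite expr2 in h; rewrite mulrBr; move: h; lra.
Qed.

Lemma log_wulff_family_small M (f : n.-tuple R -> R) h delta :
  log_wulff_family M f h delta -> forall e : R, 0 < e ->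
  exists2 d, 0 < d & forall t, 0 < `|t| < d ->
    [/\ cont_on_sphere (h t), (forall v, sphere v -> 0 < h t v) &
        forall v, sphere v ->
          `|ln (h t v) - ln (supp_fun M v) - t * f v| <= e * `|t|].
Proof.
move=> [delta0 [er [ht oe]]] e e0; have [d d0 od] := oe e e0.
exists (Num.min d delta); first by rewrite lt_min d0.
move=> t; rewrite lt_min => /and3P[t0 td tdelta].
have [h0 ch _ lnh] := ht t tdelta; split=> // v sv.
have := od t _ v sv; rewrite t0 td => /(_ isT).
rewrite normrM normfV ler_pdivrMr//; congr (_ <= _).
by rewrite lnh//; congr (`| _ |); ring.
Qed.

Variables (M : set (n.-tuple R)) (f : n.-tuple R -> R) (h : R -> n.-tuple R -> R).
Variable delta : R.
Hypotheses (cM : convex_body_o M) (cf : cont_on_sphere f)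
  (hM : log_wulff_family M f h delta).

Lemma radial_contact u : sphere u -> wulff_contact (supp_fun M) u (radial M u).
Proof.
move=> su; apply: radial_wulff_contact => //.
- exact: cont_on_sphere_supp_fun.
- by move=> v; exact: supp_fun_gt0.
- exact: convex_body_eq_wulff.
Qed.

Lemma radial_gt0 u : sphere u -> 0 < radial M u.
Proof. by move=> /radial_contact[]. Qed.

Lemma cont_on_sphere_radialM : cont_on_sphere (radial M).
Proof.
apply: (@cont_on_sphere_radial _ _ (supp_fun M)).
- exact: cont_on_sphere_supp_fun.
- by move=> v; exact: supp_fun_gt0.
- exact: convex_body_eq_wulff.
Qed.

Lemma radial_family_cont : exists2 d, 0 < d & forall t, 0 < `|t| < d ->
  cont_on_sphere (radial (wulff h t)) /\
  forall u, sphere u -> wulff_contact (h t) u (radial (wulff h t) u).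
Proof.
have [d d0 hd] := log_wulff_family_small hM ltr01.
exists d => // t /hd[ch h0 _]; split=> [|u su].
  exact: cont_on_sphere_radial ch h0 erefl.
exact: radial_wulff_contact ch h0 erefl su.
Qed.

Lemma ln_radial_bound : exists2 C, 0 < C & exists2 d, 0 < d &
  forall t, 0 < `|t| < d -> forall u, sphere u ->
    `|ln (radial (wulff h t) u) - ln (radial M u)| <= C * `|t|.
Proof.
have [d d0 hd] := log_wulff_family_small hM ltr01.
have [d' d'0 hd'] := radial_family_cont.
have [B B0 fB] := cont_on_sphere_bounded cf.
exists (1 + B); first by rewrite ltr_wpDl// ltW.
exists (Num.min d d'); first by rewrite lt_min d0.
move=> t; rewrite lt_min => /and3P[t0 td td'] u su.
have [_ h0 hl] := hd t (introT andP (conj t0 td)).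
have [_ /(_ u su) ct] := hd' t (introT andP (conj t0 td')).
have c0 := radial_contact su.
have key v : sphere v -> `|ln (h t v) - ln (supp_fun M v)| <= (1 + B) * `|t|.
  move=> sv; rewrite -[X in `|X|](subrK (t * f v)).
  apply: le_trans (ler_normD _ _) _; rewrite mulrDl lerD ?hl//.
  by rewrite normrM mulrC ler_wpM2r ?fB.
have [r0 _ [v sv uv]] := c0; have [rt0 _ [w sw uw]] := ct.
rewrite ler_norml; apply/andP; split.
  rewrite lerNl opprB.
  have := ln_radial_le rt0 sw (h0 w sw) (supp_fun_gt0 cM sw) c0 uw.
  move/le_trans; apply; rewrite -opprB lerNl.
  by have := key w sw; rewrite ler_norml => /andP[].
have := ln_radial_le r0 sv (supp_fun_gt0 cM sv) (h0 v sv) ct uv.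
by move/le_trans; apply; have := key v sv; rewrite ler_norml => /andP[].
Qed.

(* Danskin's argument: a contact direction of [M] at [u] bounds the increment of
   [ln (radial _ u)] from above, and a contact direction of the perturbed body
   bounds it from below; by compactness the latter is nearly a contact direction
   of [M], so [f] is close to [F] there. *)
Lemma ln_radial_deriv u (F : R) : sphere u ->
  (forall v, sphere v -> radial M u * dot u v = supp_fun M v -> f v = F) ->
  forall e, 0 < e -> exists2 d, 0 < d & forall t, 0 < `|t| < d ->
    `|ln (radial (wulff h t) u) - ln (radial M u) - t * F| <= e * `|t|.
Proof.
move=> su fF e e0.
have e20 : 0 < e / 2 by rewrite divr_gt0.
have [C C0 [d1 d10 hC]] := ln_radial_bound.
have [d2 d20 h2] := log_wulff_family_small hM e20.
have [d3 d30 h3] := log_wulff_family_small hM ltr01.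
have [d4 d40 h4] := radial_family_cont.
have [B B0 fB] := cont_on_sphere_bounded cf.
have [H H0 MH] := cont_on_sphere_bounded (cont_on_sphere_supp_fun cM).
have c0 := radial_contact su; have [r0 rle [v0 sv0 uv0]] := c0.
pose g v := (supp_fun M v - radial M u * dot u v) +
            (`|e / 2 - `|f v - F| | + (e / 2 - `|f v - F|)).
have [m m0 gm] : exists2 m, 0 < m & forall v, sphere v -> m <= g v.
  apply: cont_on_sphere_min.
    apply/cont_on_sphereP => v sv.
    have cfv : f w @[w --> sphere_nbhs v] --> f v by move/cont_on_sphereP: cf; apply.
    have cSv : supp_fun M w @[w --> sphere_nbhs v] --> supp_fun M v.
      by have /cont_on_sphereP := cont_on_sphere_supp_fun cM; apply.
    have cdv : dot u w @[w --> sphere_nbhs v] --> dot u v.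
      apply/cvgrPdist_lt => e' e'0; exists e' => // w sw vw.
      by apply: le_lt_trans vw; rewrite -dotBr (le_trans (normr_dot_le _ _))// su mul1r.
    have cgv : e / 2 - `|f w - F| @[w --> sphere_nbhs v] --> e / 2 - `|f v - F|.
      apply: cvgB; first exact: cvg_cst.
      by apply: cvg_norm; apply: cvgB => //; exact: cvg_cst.
    apply: cvgD; first by apply: cvgB => //; exact: cvgMr.
    by apply: cvgD => //; exact: cvg_norm.
  move=> v sv; rewrite /g.
  have := rle v sv; rewrite -subr_ge0 le_eqVlt => /predU1P[uv|uv].
    rewrite (fF v sv) ?subrr ?normr0 ?subr0; last first.
      by apply/eqP; rewrite eq_sym -subr_eq0 -uv.
    by rewrite -uv add0r ger0_norm ?(ltW e20)// addr_gt0.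
  by rewrite ltr_wpDr// normrD_self_ge0.
pose s := m / (H * (C + (1 + B))).
have CB : 0 < C + (1 + B) by rewrite !addr_gt0.
have s0 : 0 < s by rewrite divr_gt0// mulr_gt0.
exists (Num.min (Num.min d1 d2) (Num.min (Num.min d3 d4) s)).
  by rewrite !lt_min d10 d20 d30 d40.
move=> t /andP[t0]; rewrite !lt_min => /andP[/andP[td1 td2]] /andP[/andP[td3 td4]] ts.
have {}hC := hC t (introT andP (conj t0 td1)) u su.
have {h2}[_ h0 h2] := h2 t (introT andP (conj t0 td2)).
have {h3}[_ _ h3] := h3 t (introT andP (conj t0 td3)).
have [_ /(_ u su) ct] := h4 t (introT andP (conj t0 td4)).
have [rt0 _ [v sv uv]] := ct.
have hv := h0 v sv; have Mv := supp_fun_gt0 cM sv.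
have duv0 : 0 < dot u v by rewrite -(pmulr_rgt0 _ rt0) uv.
set L := ln (radial (wulff h t) u) - ln (radial M u) in hC *.
have Lup : L <= ln (h t v0) - ln (supp_fun M v0).
  exact: ln_radial_le r0 sv0 (supp_fun_gt0 cM sv0) (h0 v0 sv0) ct uv0.
have Llow : ln (h t v) - ln (supp_fun M v) <= L.
  rewrite -lerN2 !opprB.
  exact: ln_radial_le rt0 sv hv Mv c0 uv.
have fv : `|f v - F| <= e / 2.
  have : g v < m + (`|e / 2 - `|f v - F| | + (e / 2 - `|f v - F|)).
    rewrite ltrD2r.
    pose X := ln (h t v) - ln (supp_fun M v) - L.
    have XE : radial M u * dot u v = supp_fun M v * expR X.
      rewrite -[in LHS](lnK r0) -[in LHS](lnK duv0) -[in RHS](lnK Mv) -!expRD.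
      congr expR; rewrite /X /L -uv lnM ?posrE//; ring.
    have hX : `|X| <= (C + (1 + B)) * `|t|.
      rewrite /X -[X in `|X - L|](subrK (t * f v)).
      have := h3 v sv; have := hC.
      have : `|t * f v| <= B * `|t| by rewrite normrM mulrC ler_wpM2r ?fB.
      set a := _ - t * f v; set b := t * f v; rewrite !ler_norml.
      by move=> /andP[? ?] /andP[? ?] /andP[? ?]; apply/andP; split; lra.
    rewrite XE; apply: le_lt_trans (_ : H * `|X| < m).
      rewrite -[X in X - _]mulr1 -mulrBr; apply: ler_pM => //.
      - exact: ltW.
      - by rewrite subr_ge0 -(ler_pM2l Mv) mulr1 -XE rle.
      - by apply: le_trans (MH v sv); exact: ler_norm.
      have := expR_ge1Dx X; have := ler_norm (- X); rewrite normrN; lra.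
    apply: le_lt_trans (_ : H * ((C + (1 + B)) * `|t|) < m).
      by rewrite ler_pM2l.
    by rewrite mulrA mulrC -ltr_pdivlMr// mulr_gt0.
  move=> /(le_lt_trans (gm v sv)); rewrite ltrDl => gv.
  rewrite leNgt; apply/negP; rewrite -subr_lt0 => ev.
  by move: gv; rewrite ltr0_norm// addNr ltxx.
have H2v := h2 v sv; have H2v0 := h2 v0 sv0; rewrite (fF v0 sv0 uv0) in H2v0.
have tf : `|t * f v - t * F| <= e / 2 * `|t|.
  by rewrite -mulrBr normrM mulrC ler_wpM2r.
move: H2v H2v0 tf; rewrite !ler_norml => /andP[? ?] /andP[? ?] /andP[? ?].
by apply/andP; split; lra.
Qed.

Variable q : R.

Lemma powR_sub_expR (r r' : R) : 0 < r -> 0 < r' ->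
  r' `^ q - r `^ q = r `^ q * (expR (q * (ln r' - ln r)) - 1).
Proof.
move=> r0 r'0; rewrite mulrBr mulr1 /powR !gt_eqF//.
by rewrite -expRD; congr (expR _ - _); ring.
Qed.

Lemma powR_radial_bound : exists2 C, 0 < C & exists2 d, 0 < d &
  forall t, 0 < `|t| < d -> forall u, sphere u ->
    `|(radial (wulff h t) u `^ q - radial M u `^ q) / t| <= C.
Proof.
have [C C0 [d1 d10 hC]] := ln_radial_bound.
have [d2 d20 h2] := radial_family_cont.
have [B B0 rB] : exists2 B : R, 0 < B & forall u, sphere u -> `|radial M u `^ q| <= B.
  apply: cont_on_sphere_bounded.
  by apply: cont_on_sphere_powR; [exact: radial_gt0|exact: cont_on_sphere_radialM].
pose s := 1 / 2 / ((`|q| + 1) * C).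
have q1 : 0 < `|q| + 1 by rewrite ltr_wpDl.
have s0 : 0 < s by rewrite !divr_gt0// mulr_gt0.
exists (B * (2 * ((`|q| + 1) * C))); first by rewrite !mulr_gt0.
exists (Num.min (Num.min d1 d2) s); first by rewrite !lt_min d10 d20.
move=> t /andP[t0]; rewrite !lt_min => /andP[/andP[td1 td2]] ts u su.
have r0 := radial_gt0 su.
have [_ /(_ u su)[rt0 _ _]] := h2 t (introT andP (conj t0 td2)).
have {}hC := hC t (introT andP (conj t0 td1)) u su.
have qL : `|q * (ln (radial (wulff h t) u) - ln (radial M u))| <=
    (`|q| + 1) * C * `|t|.
  by rewrite normrM -mulrA ler_pM// lerDl.
rewrite powR_sub_expR// normrM normfV ler_pdivrMr// normrM -!mulrA.
rewrite ler_pM ?rB//; apply: le_trans (expR_sub1_le _) _.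
  apply: le_trans qL _; rewrite mulrC -ler_pdivlMr ?mulr_gt0//.
  exact: ltW.
by rewrite ler_pM2l// mulrA.
Qed.

Lemma powR_radial_deriv u (F : R) : sphere u ->
  (forall v, sphere v -> radial M u * dot u v = supp_fun M v -> f v = F) ->
  forall e, 0 < e -> exists2 d, 0 < d & forall t, 0 < `|t| < d ->
    `|(radial (wulff h t) u `^ q - radial M u `^ q) / t
       - q * (F * radial M u `^ q)| <= e.
Proof.
move=> su fF e e0.
have [C C0 [d1 d10 hC]] := ln_radial_bound.
have [d2 d20 h2] := radial_family_cont.
have r0 := radial_gt0 su.
have q1 : 0 < `|q| + 1 by rewrite ltr_wpDl.
have rq0 : 0 < radial M u `^ q by rewrite powR_gt0.
pose e' := e / (2 * (`|q| + 1) * radial M u `^ q).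
have e'0 : 0 < e' by rewrite divr_gt0// !mulr_gt0.
have [d3 d30 h3] := ln_radial_deriv su fF e'0.
pose A := (`|q| + 1) * C.
have A0 : 0 < A by rewrite mulr_gt0.
pose s := 1 / 2 / A.
pose s' := e / (radial M u `^ q * (4 * A ^+ 2)).
have s0 : 0 < s by rewrite !divr_gt0// mulr_gt0.
have s'0 : 0 < s' by rewrite !(divr_gt0, mulr_gt0)// exprn_gt0.
exists (Num.min (Num.min d1 d2) (Num.min (Num.min d3 s) s')).
  by rewrite !lt_min d10 d20 d30 s0.
move=> t /andP[t0].
rewrite !lt_min => /andP[/andP[td1 td2]] /andP[/andP[td3 ts] ts'].
have [_ /(_ u su)[rt0 _ _]] := h2 t (introT andP (conj t0 td2)).
have {}hC := hC t (introT andP (conj t0 td1)) u su.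
have {}h3 := h3 t (introT andP (conj t0 td3)).
set L := ln _ - ln _ in hC h3.
have qL : `|q * L| <= A * `|t| by rewrite normrM -mulrA ler_pM// lerDl.
have qL2 : `|q * L| <= 1 / 2.
  by apply: le_trans qL _; rewrite mulrC -ler_pdivlMr//; exact: ltW.
have tN0 : t != 0 by rewrite -normr_gt0.
rewrite powR_sub_expR// -/L.
set w := radial M u `^ q in rq0 e' e'0 h3 s' s'0 ts' *.
have -> : w * (expR (q * L) - 1) / t - q * (F * w) =
    w * ((expR (q * L) - 1 - q * L) + q * (L - t * F)) / t by field.
rewrite normrM normfV ler_pdivrMr// normrM (gtr0_norm rq0).
have E1 : `|expR (q * L) - 1 - q * L| <= 2 * (A * `|t|) ^+ 2.
  apply: le_trans (expR_sub1_taylor qL2) _.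
  rewrite ler_pM2l// -(real_normK (num_real (q * L))).
  by rewrite lerXn2r ?nnegrE// mulr_ge0// ltW.
have E2 : `|q * (L - t * F)| <= (`|q| + 1) * (e' * `|t|).
  by rewrite normrM ler_pM// lerDl.
apply: (@le_trans _ _ (w * (2 * (A * `|t|) ^+ 2 + (`|q| + 1) * (e' * `|t|)))).
  by rewrite ler_pM2l//; apply: le_trans (ler_normD _ _) _; exact: lerD.
have -> : w * (2 * (A * `|t|) ^+ 2 + (`|q| + 1) * (e' * `|t|)) =
    (w * (4 * A ^+ 2) * `|t|) * `|t| / 2 + (e' * (2 * (`|q| + 1) * w)) * `|t| / 2.
  by field.
have -> : e' * (2 * (`|q| + 1) * w) = e.
  by rewrite /e' divfK// gt_eqF// !mulr_gt0.
have : w * (4 * A ^+ 2) * `|t| <= e.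
  rewrite mulrC -ler_pdivlMr; first exact: ltW.
  by rewrite !mulr_gt0// exprn_gt0.
move=> /(ler_wpM2r (ltW t0)); lra.
Qed.

End Variation.

Section Sphere_measurability.
Context {R : realType} {n : nat}.
Local Notation T := (n.-tuple R).
Implicit Types (u v w x y : T) (U : set T) (g : T -> R).

Lemma measurable_enorm_comp (phi : T -> T) :
  (forall i, measurable_fun [set: T] (fun x => tnth (phi x) i)) ->
  measurable_fun [set: T] (fun x => enorm (phi x)).
Proof.
move=> mphi; rewrite /enorm.
have -> : (fun x => Num.sqrt (dot (phi x) (phi x))) =
    Num.sqrt \o (fun x => dot (phi x) (phi x)) by [].
apply: measurableT_comp.
  apply: continuous_measurable_fun; exact: sqrt_continuous.
by apply: measurable_sum => i; exact: measurable_funM.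
Qed.

Lemma measurable_enorm : measurable_fun [set: T] enorm.
Proof. by apply: measurable_enorm_comp => i; exact: measurable_tnth. Qed.

Lemma measurable_enorm_vsub c : measurable_fun [set: T] (fun x => enorm (vsub c x)).
Proof.
apply: measurable_enorm_comp => i.
have -> : (fun x => tnth (vsub c x) i) = (fun x => tnth c i - tnth x i).
  by apply/funext => x; rewrite !tnth_mktuple mulN1r.
by apply: measurable_funB; [exact: measurable_cst|exact: measurable_tnth].
Qed.

Lemma measurable_normalize : measurable_fun [set: T] (@normalize R n).
Proof.
apply/measurable_fun_tnthP => i.
have -> : (fun x => tnth x i) \o @normalize R n =
    (fun x => enorm x `^ (-1) * tnth x i).
  by apply/funext => x /=; rewrite tnth_mktuple powR_inv1 ?enorm_ge0.
apply: measurable_funM; last exact: measurable_tnth.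
rewrite (_ : (fun x => _) = (@powR R ^~ (-1)) \o enorm)//.
by apply: measurableT_comp; [exact: measurable_powR|exact: measurable_enorm].
Qed.

Lemma measurable_sphere : measurable (@sphere R n).
Proof.
rewrite (_ : sphere = (@enorm R n) @^-1` [set 1])// -[X in measurable X]setTI.
by apply: measurable_enorm => //; exact: measurable_set1.
Qed.

Lemma rat_tuple_approx u (e : R) : 0 < e -> exists c : n.-tuple rat,
  enorm (vsub [tuple ratr (tnth c i) | i < n] u) < e.
Proof.
move=> e0; pose e' := e / (n%:R + 1).
have n1 : 0 < n%:R + 1 :> R by rewrite ltr_wpDl.
have e'0 : 0 < e' by rewrite divr_gt0.
have /choice[c cP] : forall i, exists r : rat, `|ratr r - tnth u i| <= e'.
  move=> i; have /rat_in_itvoo[r] : tnth u i < tnth u i + e' by rewrite ltrDl.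
  rewrite in_itv/= => /andP[r1 r2]; exists r.
  by rewrite ger0_norm ?subr_ge0 ?(ltW r1)// lerBlDl ltW.
exists [tuple c i | i < n].
have : enorm (vsub [tuple ratr (tnth [tuple c i0 | i0 < n] i) | i < n] u) <= e' * n%:R.
  apply: enorm_le_coord; first exact: ltW.
  by move=> i; rewrite !tnth_mktuple mulN1r.
move=> /le_lt_trans; apply.
by rewrite -mulrA gtr_pMr// mulrC ltr_pdivrMr// mul1r ltrDl.
Qed.

Definition sphere_open U := U `<=` sphere /\ forall u, U u ->
  exists2 d : R, 0 < d & forall w, sphere w -> enorm (vsub u w) < d -> U w.

Lemma sphere_open_measurable U : sphere_open U -> measurable U.
Proof.
move=> [Us Uo].
pose rv (c : n.-tuple rat) : T := [tuple ratr (tnth c i) | i < n].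
pose cap (p : n.-tuple rat * rat) :=
  sphere `&` [set w | enorm (vsub (rv p.1) w) < ratr p.2].
pose F p := if `[< cap p `<=` U >] then cap p else set0.
have -> : U = \bigcup_p F p.
  apply/seteqP; split=> [u Uu|u [p _]]; last by rewrite /F; case: asboolP => // /(_ u).
  have [d d0 Ud] := Uo u Uu.
  have /rat_in_itvoo[r] : 0 < d / 2 by rewrite divr_gt0.
  rewrite in_itv/= => /andP[r0 rd].
  have [c cu] := rat_tuple_approx u r0.
  exists (c, r) => //; rewrite /F; case: asboolP => [_|].
    by split => //=; exact: Us.
  move=> []; move=> w [sw /= cw]; apply: Ud => //.
  apply: le_lt_trans (enorm_vsub_triangle (rv c) _ _) _.
  rewrite (enorm_vsubC u) [ltRHS]splitr.
  by rewrite ltrD// (lt_trans _ rd).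
apply: countable_bigcupT_measurable => // p.
rewrite /F; case: asboolP => // _; apply: measurableI; first exact: measurable_sphere.
rewrite -[X in measurable X]setTI.
have -> : [set w | enorm (vsub (rv p.1) w) < ratr p.2] =
    (fun w => enorm (vsub (rv p.1) w)) @^-1` `]-oo, (ratr p.2 : R)[%classic.
  by apply/seteqP; split => w /=; rewrite in_itv.
by apply: measurable_enorm_vsub => //; exact: measurable_itv.
Qed.

Lemma cont_on_sphere_measurable g : cont_on_sphere g -> measurable_fun sphere g.
Proof.
move=> cg mS; apply: (measurability _ (RGenOInfty.measurableE R)) => //.
move=> /= _ [_ [a ->] <-]; rewrite preimage_itvoy.
apply: sphere_open_measurable; split=> [u []//|u [su /= au]].
have [|d d0 gd] := cg u su (g u - a); first by rewrite subr_gt0.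
exists d => // w sw uw; split => //=.
by have := gd w sw uw; rewrite ltr_norml => /andP[_]; rewrite ltrD2l ltrN2.
Qed.

(* The truncated cone over [U] carries the spherical measure of [U] in [sph_int]. *)
Definition cone U : set T := [set x | (0 < enorm x <= 1)%R /\ U (normalize x)].

Lemma measurable_cone U : measurable U -> measurable (cone U).
Proof.
move=> mU.
have -> : cone U = (@enorm R n @^-1` `]0, 1]) `&` (@normalize R n @^-1` U).
  by apply/seteqP; split => x /=; rewrite in_itv/=.
apply: measurableI; rewrite -[X in measurable X]setTI.
  by apply: measurable_enorm => //; exact: measurable_itv.
exact: measurable_normalize.
Qed.

Lemma measurable_fun_normalize U g : measurable U ->
  measurable_fun U g -> measurable_fun (cone U) (g \o @normalize R n).
Proof.
move=> mU mg; apply: (measurable_comp mU _ mg).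
  by move=> _ [x [_ Ux] <-].
exact: measurable_funTS measurable_normalize.
Qed.

Lemma lebesgue_tuple_cone_lty (lam : {measure set T -> \bar R}) :
  lebesgue_tuple lam -> (lam (cone sphere) < +oo)%E.
Proof.
move=> lebl.
pose box := [set x : T | forall i, tnth [tuple (-2) | _ < n] i < tnth x i <= tnth [tuple 2 | _ < n] i].
have mbox : measurable box.
  have -> : box = \bigcap_(i in [set: 'I_n]) ((@tnth n R)^~ i @^-1` `](-2), 2]).
    apply/seteqP; split=> [x bx i _|x bx i].
      by have := bx i; rewrite !tnth_mktuple /= in_itv.
    by have := bx i I; rewrite !tnth_mktuple /= in_itv.
  apply: fin_bigcap_measurable => // i _.
  by rewrite -[X in measurable X]setTI; apply: measurable_tnth => //; exact: measurable_itv.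
apply: (@le_lt_trans _ _ (lam box)).
  apply: le_measure; rewrite ?inE//.
    by apply: measurable_cone; exact: measurable_sphere.
  move=> x [/andP[_ x1] _] i; rewrite !tnth_mktuple.
  have := le_trans (coord_le_enorm x i) x1; rewrite ler_norml => /andP[? ?].
  by apply/andP; split; lra.
rewrite lebl ?ltry// => i; rewrite !tnth_mktuple; lra.
Qed.

End Sphere_measurability.

Section Integrals.
Local Open Scope ereal_scope.

Lemma ge0_le_integralT d (T : measurableType d) (R : realType)
    (mu : {measure set T -> \bar R}) (f g : T -> \bar R) :
  (forall x, 0 <= f x) -> (forall x, f x <= g x) ->
  \int[mu]_x f x <= \int[mu]_x g x.
Proof.
move=> f0 fg; rewrite !ge0_integralTE//; last by move=> x; exact: le_trans (fg x).
apply: ge_ereal_sup => _ [h hf <-]; apply: ereal_sup_ubound; exists h => // x.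
exact: le_trans (fg x).
Qed.

(* No measurability is asked from [D]: for non-measurable sets the integral is the
   lower integral, which is still monotone. *)
Lemma integral_null_sandwich d (T : measurableType d) (R : realType)
    (mu : {measure set T -> \bar R}) (A D N : set T) (f : T -> \bar R) :
  measurable A -> measurable N -> mu N = 0 -> A `<=` D -> D `<=` A `|` N ->
  measurable_fun (A `|` N) f -> (forall x, 0 <= f x) ->
  \int[mu]_(x in D) f x = \int[mu]_(x in A) f x.
Proof.
move=> mA mN N0 AD DAN mf f0.
have sub (B C : set T) : B `<=` C -> \int[mu]_(x in B) f x <= \int[mu]_(x in C) f x.
  move=> BC; rewrite (integral_mkcond B) (integral_mkcond C).
  apply: ge0_le_integralT => x; rewrite !patchE; first by case: ifP.
  case: ifPn => [xB|_]; last by case: ifP.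
  by rewrite ifT// inE; apply: BC; rewrite inE in xB.
apply/eqP; rewrite eq_le; apply/andP; split; last exact: sub.
apply: le_trans (sub _ _ DAN) _.
rewrite (@ge0_negligible_integral _ _ _ _ _ N)//; last exact: measurableU.
by apply: sub => x [[]].
Qed.

Section transfer.
Context d1 d2 (T1 : measurableType d1) (T2 : measurableType d2) (R : realType).
Variables (m1 : {measure set T1 -> \bar R}) (m2 : {measure set T2 -> \bar R}).
Variables (D1 : set T1) (D2 : set T2) (g1 w1 : T1 -> R) (g2 w2 : T2 -> R).
Hypotheses (mD1 : measurable D1) (mD2 : measurable D2).
Hypotheses (mg1 : measurable_fun D1 g1) (mg2 : measurable_fun D2 g2).
Hypotheses (mw1 : measurable_fun D1 w1) (mw2 : measurable_fun D2 w2).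
Hypotheses (g10 : forall x, D1 x -> (0 <= g1 x)%R) (g20 : forall x, D2 x -> (0 <= g2 x)%R).
Hypotheses (w10 : forall x, D1 x -> (0 <= w1 x)%R) (w20 : forall x, D2 x -> (0 <= w2 x)%R).
Hypothesis g12 : forall A, measurable A ->
  \int[m1]_(x in D1 `&` g1 @^-1` A) (w1 x)%:E =
  \int[m2]_(x in D2 `&` g2 @^-1` A) (w2 x)%:E.

Lemma integral_transfer_le (e : R) : (0 < e)%R ->
  \int[m1]_(x in D1) (g1 x * w1 x)%:E <= \int[m2]_(x in D2) ((g2 x + e) * w2 x)%:E.
Proof.
move=> e0; pose P (k : nat) : set R := `[(k%:R * e)%R, (k.+1%:R * e)%R[%classic.
have mP k : measurable (P k) by exact: measurable_itv.
have tP d (T : measurableType d) (D : set T) (g : T -> R) :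
    trivIset setT (fun k => D `&` g @^-1` (P k)).
  have lt k l y : P k y -> P l y -> (k <= l)%N.
    rewrite /P/= !in_itv/= => /andP[ky _] /andP[_ yl].
    by have := le_lt_trans ky yl; rewrite ltr_pM2r// ltr_nat ltnS.
  apply/trivIsetP => k l _ _ kl; rewrite -subset0 => x [[_ /= xk] [_ /= xl]].
  by move/eqP: kl; apply; apply/eqP; rewrite eqn_leq (lt _ _ _ xk xl) (lt _ _ _ xl xk).
have DP d (T : measurableType d) (D : set T) (g : T -> R) :
    (forall x, D x -> (0 <= g x)%R) -> D = \bigcup_k (D `&` g @^-1` (P k)).
  move=> g0; apply/seteqP; split=> [x Dx|x [k _ []]//].
  have ge0 : (0 <= g x / e)%R by rewrite divr_ge0 ?g0// ltW.
  have := truncn_itv ge0 => /andP[t1 t2].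
  exists (Num.truncn (g x / e)) => //; split => //.
  by rewrite /P/= in_itv/= -ler_pdivlMr// t1 -ltr_pdivrMr.
have mDP1 k : measurable (D1 `&` g1 @^-1` (P k)) by exact: mg1.
have mDP2 k : measurable (D2 `&` g2 @^-1` (P k)) by exact: mg2.
rewrite (DP _ _ _ _ g10) (DP _ _ _ _ g20).
rewrite ge0_integral_bigcup//; last 3 first.
- by rewrite -(DP _ _ _ _ g10); apply/measurable_EFinP; exact: measurable_funM.
- by move=> x; rewrite -(DP _ _ _ _ g10) => Dx; rewrite lee_fin mulr_ge0 ?g10 ?w10.
- exact: tP.
rewrite ge0_integral_bigcup//; last 3 first.
- rewrite -(DP _ _ _ _ g20); apply/measurable_EFinP; apply: measurable_funM => //.
  by apply: measurable_funD.
- move=> x; rewrite -(DP _ _ _ _ g20) => Dx.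
  by rewrite lee_fin mulr_ge0 ?w20// addr_ge0 ?g20// ltW.
- exact: tP.
apply: lee_nneseries => k _.
  by move=> _; apply: integral_ge0 => x [Dx _]; rewrite lee_fin mulr_ge0 ?g10 ?w10.
have ke0 : (0 <= k.+1%:R * e)%R by rewrite mulr_ge0 ?(ltW e0).
have sub1 : D1 `&` g1 @^-1` (P k) `<=` D1 by exact: subIsetl.
have sub2 : D2 `&` g2 @^-1` (P k) `<=` D2 by exact: subIsetl.
apply: (@le_trans _ _
    (\int[m1]_(x in D1 `&` g1 @^-1` (P k)) ((k.+1%:R * e)%:E * (w1 x)%:E))).
  apply: ge0_le_integral => //.
  - by move=> x [Dx _]; rewrite lee_fin mulr_ge0 ?g10 ?w10.
  - apply/measurable_EFinP; apply: (measurable_funS mD1 sub1).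
    exact: measurable_funM.
  - apply/measurable_EFinP; apply: (measurable_funS mD1 sub1).
    exact: measurable_funM.
  - move=> x [Dx]; rewrite /P/= in_itv/= => /andP[_ /ltW gk].
    by rewrite lee_fin ler_wpM2r ?w10.
rewrite ge0_integralZl_EFin//; last 2 first.
- by move=> x [Dx _]; rewrite lee_fin w10.
- apply/measurable_EFinP; exact: (measurable_funS mD1 sub1).
rewrite g12// -ge0_integralZl_EFin//; last 2 first.
- by move=> x [Dx _]; rewrite lee_fin w20.
- apply/measurable_EFinP; exact: (measurable_funS mD2 sub2).
apply: ge0_le_integral => //.
- by move=> x [Dx _]; rewrite lee_fin mulr_ge0 ?w20.
- apply/measurable_EFinP; apply: (measurable_funS mD2 sub2).
  exact: measurable_funM.
- apply/measurable_EFinP; apply: (measurable_funS mD2 sub2).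
  by apply: measurable_funM => //; exact: measurable_funD.
- move=> x [Dx]; rewrite /P/= in_itv/= => /andP[gk _].
  rewrite lee_fin ler_wpM2r ?w20//.
  by rewrite -natr1 mulrDl mul1r lerD2r.
Qed.

Lemma integral_transfer_le_fin :
  \int[m2]_(x in D2) (w2 x)%:E < +oo ->
  \int[m1]_(x in D1) (g1 x * w1 x)%:E <= \int[m2]_(x in D2) (g2 x * w2 x)%:E.
Proof.
have W0 : 0 <= \int[m2]_(x in D2) (w2 x)%:E.
  by apply: integral_ge0 => x Dx; rewrite lee_fin w20.
move: W0; case E : (\int[m2]_(x in D2) (w2 x)%:E) => [W| |]// W0 _.
apply/lee_addgt0Pr => e e0.
have W1 : (0 < W + 1)%R by rewrite ltr_wpDl.
have e'0 : (0 < e / (W + 1))%R by rewrite divr_gt0.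
apply: le_trans (integral_transfer_le e'0) _.
under eq_integral => x _ do rewrite mulrDl EFinD EFinM.
rewrite ge0_integralD//; last 4 first.
- by move=> x Dx; rewrite lee_fin mulr_ge0 ?g20 ?w20.
- by apply/measurable_EFinP; exact: measurable_funM.
- by move=> x Dx; rewrite lee_fin mulr_ge0 ?w20// ltW.
- by apply/measurable_EFinP; exact: measurable_funM.
rewrite leeD2l//.
under eq_integral => x _ do rewrite EFinM.
rewrite ge0_integralZl_EFin ?(ltW e'0)//; last exact/measurable_EFinP.
rewrite E -EFinM lee_fin -mulrA ger_pMr//.
by rewrite mulrC ler_pdivrMr// mul1r lerDl.
Qed.

End transfer.
End Integrals.

Section Curvature_measure.
Context {R : realType} {n : nat}.
Local Notation T := (n.-tuple R).
Variables (lam mu : {measure set T -> \bar R}).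
Variables (M Q : set T) (f : T -> R) (q j : R).
Hypotheses (n_gt0 : (0 < n)%N) (lebl : lebesgue_tuple lam).
Hypotheses (cM : convex_body_o M) (cf : cont_on_sphere f) (sQ : star_body_o Q).
Hypothesis muE : forall eta, measurable eta -> eta `<=` sphere ->
  mu eta = Ctilde lam q j M Q eta.
Implicit Types (u v w x y : T).

Lemma cont_on_sphere_dot u : sphere u -> cont_on_sphere (dot u).
Proof.
move=> su; apply: (@lipschitz_cont_on_sphere _ _ _ 1) => v w _ _.
by rewrite -dotBr -su cauchy_schwarz.
Qed.

Lemma Rstar_sublevel_measurable (g : T -> R) (a : R) : cont_on_sphere g ->
  measurable (Rstar M (sphere `&` [set v | g v <= a])).
Proof.
move=> cg.
pose G u v := (supp_fun M v - radial M u * dot u v) + (`|g v - a| + (g v - a)).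
have -> : Rstar M (sphere `&` [set v | g v <= a]) =
    \bigcap_k [set u | sphere u /\ exists2 v, sphere v & G u v < k.+1%:R^-1].
  apply/seteqP; split=> [u [su [v [sv /= gv]]]|u Gu].
    rewrite dotZl => uv k _; split => //; exists v => //.
    by rewrite /G uv subrr add0r ler0_norm ?subr_le0// addNr invr_gt0 ltr0n.
  have [su _] := Gu 0%N I; split => //.
  have [_ rle _] := radial_contact cM su.
  apply: contrapT => nv.
  have [||m m0 Gm] := @cont_on_sphere_min _ _ (G u).
  - move/cont_on_sphereP in cg; apply/cont_on_sphereP => v sv.
    have cS : supp_fun M w @[w --> sphere_nbhs v] --> supp_fun M v.
      by have /cont_on_sphereP := cont_on_sphere_supp_fun cM; apply.
    have cd : dot u w @[w --> sphere_nbhs v] --> dot u v.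
      by have /cont_on_sphereP := cont_on_sphere_dot su; apply.
    have cga : g w - a @[w --> sphere_nbhs v] --> g v - a.
      by apply: cvgB; [exact: cg|exact: cvg_cst].
    apply: cvgD; first by apply: cvgB => //; exact: cvgMr.
    by apply: cvgD => //; exact: cvg_norm.
  - move=> v sv; rewrite /G.
    have := rle v sv; rewrite -subr_ge0 le_eqVlt => /predU1P[uv|uv]; last first.
      by rewrite ltr_wpDr// normrD_self_ge0.
    rewrite -uv add0r; have [ga|ga] := leP (g v) a.
      exfalso; apply: nv; exists v => //; rewrite dotZl.
      by apply/eqP; rewrite eq_sym -subr_eq0 -uv.
    by rewrite gtr0_norm ?subr_gt0// addr_gt0 ?subr_gt0.
  have [k _ /(_ k (leqnn k))] := near_infty_natSinv_lt (PosNum m0).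
  move=> /= km; have [_ [v sv Gv]] := Gu k I.
  by have := lt_trans (le_lt_trans (Gm v sv) Gv) km; rewrite ltxx.
apply: bigcapT_measurable => k; apply: sphere_open_measurable.
split=> [u []//|u [su [v sv Guv]]].
have cGv : cont_on_sphere (G^~ v).
  apply/cont_on_sphereP => w sw; apply: cvgD; last exact: cvg_cst.
  apply: cvgB; first exact: cvg_cst.
  apply: cvgM; first by have /cont_on_sphereP := cont_on_sphere_radialM cM; apply.
  have -> : dot^~ v = dot v by apply/funext => z; rewrite dotC.
  by rewrite dotC; have /cont_on_sphereP := cont_on_sphere_dot sv; apply.
have [|d d0 Gd] := cGv u su (k.+1%:R^-1 - G u v); first by rewrite subr_gt0.
exists d => // w sw uw; split => //; exists v => //.
have := Gd w sw uw; rewrite distrC => /(le_lt_trans (ler_norm _)).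
by rewrite ltrD2r.
Qed.

Definition weight u := radial M u `^ q * radial Q u `^ (n%:R - q - j).
Local Notation K := (@cone R n sphere).
Local Notation W := (weight \o @normalize R n).

Lemma cont_on_sphere_radialQ_powR : cont_on_sphere (fun u => radial Q u `^ (n%:R - q - j)).
Proof. by have [_ _ Q0 cQ] := sQ; exact: cont_on_sphere_powR. Qed.

Lemma cont_on_sphere_weight : cont_on_sphere weight.
Proof.
have /cont_on_sphereP cQ := cont_on_sphere_radialQ_powR.
have /cont_on_sphereP cr : cont_on_sphere (fun u => radial M u `^ q).
  apply: cont_on_sphere_powR; last exact: cont_on_sphere_radialM.
  by move=> u; exact: radial_gt0.
by apply/cont_on_sphereP => u su; apply: cvgM; [exact: cr|exact: cQ].
Qed.

Lemma weight_ge0 u : 0 <= weight u.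
Proof. by rewrite mulr_ge0 ?powR_ge0. Qed.

Lemma weight_gt0 u : sphere u -> 0 < weight u.
Proof.
move=> su; have [_ _ Q0 _] := sQ.
by rewrite mulr_gt0// powR_gt0 ?Q0//; exact: radial_gt0.
Qed.

Lemma measurable_cone_sphere : measurable K.
Proof. by apply: measurable_cone; exact: measurable_sphere. Qed.

Lemma cone_sub (U : set T) : U `<=` sphere -> cone U `<=` K.
Proof. by move=> Us x [x0 /Us]. Qed.

Lemma cont_on_sphere_integrable (g : T -> R) : cont_on_sphere g ->
  lam.-integrable K (EFin \o (g \o @normalize R n)).
Proof.
move=> cg; have [B B0 gB] := cont_on_sphere_bounded cg.
apply: measurable_bounded_integrable => //.
- exact: measurable_cone_sphere.
- exact: lebesgue_tuple_cone_lty.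
- apply: measurable_fun_normalize; first exact: measurable_sphere.
  exact: cont_on_sphere_measurable.
- exists B; split; first exact: num_real.
  by move=> y By x [_ /gB] /le_trans; apply; exact: ltW.
Qed.

Lemma integrable_weight : lam.-integrable K (EFin \o W).
Proof. exact/cont_on_sphere_integrable/cont_on_sphere_weight. Qed.

Lemma natr_mulVK (x : \bar R) : ((n%:R)^-1%:E * ((n%:R)%:E * x) = x)%E.
Proof. by rewrite muleA -EFinM mulVf ?mul1e// pnatr_eq0 -lt0n. Qed.

Lemma CtildeE eta :
  Ctilde lam q j M Q eta = (\int[lam]_(x in cone (Rstar M eta)) (W x)%:E)%E.
Proof. exact: natr_mulVK. Qed.

Lemma RstarU (A B : set T) : Rstar M (A `|` B) = Rstar M A `|` Rstar M B.
Proof.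
apply/seteqP; split=> [u [su [v [vA|vB] uv]]|u [|] [su [v vA uv]]].
- by left; split => //; exists v.
- by right; split => //; exists v.
- by split => //; exists v => //; left.
- by split => //; exists v => //; right.
Qed.

Definition overlap (a b : R) : set T :=
  cone (Rstar M (sphere `&` [set v | f v <= a]) `&`
        Rstar M (sphere `&` [set v | b <= f v])).

Lemma suplevelE (b : R) : [set v | b <= f v] = [set v | - f v <= - b].
Proof. by apply/seteqP; split => v /=; rewrite lerN2. Qed.

Lemma cont_on_sphereN (g : T -> R) : cont_on_sphere g -> cont_on_sphere (fun v => - g v).
Proof.
by move=> /cont_on_sphereP cg; apply/cont_on_sphereP => u su; apply: cvgN; exact: cg.
Qed.

Lemma sphere_sublevel_measurable (g : T -> R) (a : R) : cont_on_sphere g ->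
  measurable (sphere `&` [set v | g v <= a]).
Proof.
move=> cg; have -> : [set v | g v <= a] = g @^-1` `]-oo, a]%classic.
  by apply/seteqP; split => v /=; rewrite in_itv.
exact: (cont_on_sphere_measurable cg (@measurable_sphere R n) (measurable_itv _)).
Qed.

Lemma measurable_overlap (a b : R) : measurable (overlap a b).
Proof.
apply: measurable_cone; apply: measurableI; first exact: Rstar_sublevel_measurable.
by rewrite suplevelE; apply: Rstar_sublevel_measurable; exact: cont_on_sphereN.
Qed.

(* [mu] is additive on the disjoint sets [f <= a] and [b <= f], whereas the weight of
   the union of the two cones misses that of their intersection. *)
Lemma overlap_null (a b : R) : a < b -> lam (overlap a b) = 0%E.
Proof.
move=> ab.
set A := sphere `&` [set v | f v <= a]; set B := sphere `&` [set v | b <= f v].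
have mA : measurable A by exact: sphere_sublevel_measurable.
have mB : measurable B.
  by rewrite /B suplevelE; apply: sphere_sublevel_measurable; exact: cont_on_sphereN.
have mRA : measurable (cone (Rstar M A)).
  by apply: measurable_cone; exact: Rstar_sublevel_measurable.
have mRB : measurable (cone (Rstar M B)).
  apply: measurable_cone; rewrite /B suplevelE.
  by apply: Rstar_sublevel_measurable; exact: cont_on_sphereN.
have RK (C : set T) : cone (Rstar M C) `<=` K by apply: cone_sub => u [].
have AB : [disjoint A & B].
  apply/disj_setPS => v [[_ /= va] [_ /= bv]].
  by have := le_lt_trans va (lt_le_trans ab bv); rewrite ltxx.
have : (mu (A `|` B) = mu A + mu B)%E by apply: measureU => //; exact/disj_set2P.
have sA : A `<=` sphere by move=> v [].
have sB : B `<=` sphere by move=> v [].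
have sAB : A `|` B `<=` sphere by move=> v [/sA|/sB].
rewrite (muE (measurableU _ _ mA mB) sAB) (muE mA sA) (muE mB sB).
rewrite !CtildeE RstarU.
set X := cone (Rstar M A) in mRA *; set Y := cone (Rstar M B) in mRB *.
have -> : cone (Rstar M A `|` Rstar M B) = X `|` (Y `\` X).
  apply/seteqP; split=> [x [x0 [xA|xB]]|x [[x0 xA]|[[x0 xB] _]]].
  - by left.
  - by have [xX|xX] := pselect (X x); [left|right].
  - by split => //; left.
  - by split => //; right.
have W0 x : (0 <= (W x)%:E)%E by rewrite lee_fin weight_ge0.
have mW (C : set T) : C `<=` K -> measurable_fun C (EFin \o W).
  move=> CK; apply: measurable_funS CK _; first exact: measurable_cone_sphere.
  exact: measurable_int integrable_weight.
have finW (C : set T) : measurable C -> C `<=` K ->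
    (\int[lam]_(x in C) (W x)%:E)%E \is a fin_num.
  move=> mC CK; apply: integrable_fin_num => //.
  by apply: integrableS integrable_weight => //; exact: measurable_cone_sphere.
have [XK YK] : X `<=` K /\ Y `<=` K by split; exact: RK.
have mYX : measurable (Y `\` X) by exact: measurableD.
have mI : measurable (Y `&` X) by exact: measurableI.
have IK : Y `&` X `<=` K by move=> x [/YK].
have YXK : Y `\` X `<=` K by move=> x [/YK].
rewrite ge0_integral_setU//; last 2 first.
- by apply: mW => x [/XK|/YXK].
- by apply/disj_setPS => x [Xx [_]].
rewrite -[in X in _ = X -> _](setDUK (@subIsetl _ Y X)) setDIr setDv set0U.
rewrite ge0_integral_setU//; last 2 first.
- by apply: mW => x [/IK|/YXK].
- by apply/disj_setPS => x [[_ ?] []].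
have -> : overlap a b = Y `&` X.
  by apply/seteqP; split=> [x [x0 []]|x [[x0 ?] [_ ?]]]; split.
move: (finW _ mRA XK) (finW _ mYX YXK) (finW _ mI IK).
case: (integral _ X _) => [x| |]// _; case: (integral _ (Y `\` X) _) => [y| |]// _.
case E : (integral _ (Y `&` X) _) => [z| |]// _ [] xyz.
have z0 : z = 0 by lra.
have [m m0 mWu] := cont_on_sphere_min cont_on_sphere_weight weight_gt0.
apply/eqP; rewrite -measure_le0 -(@lee_pmul2l _ m%:E)// ?lte_fin// mule0.
rewrite -integral_cst//; apply: (@le_trans _ _ (\int[lam]_(x in Y `&` X) (W x)%:E)%E); last first.
  by rewrite E z0.
apply: ge0_le_integral => //.
- by move=> ? _; rewrite lee_fin ltW.
- exact: mW.
- by move=> y' /IK[_ sy']; rewrite lee_fin mWu.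
Qed.

Definition overlaps : set T := \bigcup_(k : nat)
  if @unpickle (rat * rat)%type k is Some ab then
    if ab.1 < ab.2 then overlap (ratr ab.1) (ratr ab.2) else set0
  else set0.

Lemma measurable_overlaps : measurable overlaps.
Proof.
apply: bigcupT_measurable => k; case: unpickle => // -[a b] /=.
by case: ifP => // _; exact: measurable_overlap.
Qed.

Lemma overlaps_null : lam overlaps = 0%E.
Proof.
apply/negligibleP; first exact: measurable_overlaps.
apply: negligible_bigcup => k; case: unpickle => [[a b]|] /=; last exact: negligible_set0.
case: ifPn => ab; last exact: negligible_set0.
apply/negligibleP; first exact: measurable_overlap.
by apply: overlap_null; rewrite ltr_rat.
Qed.

Lemma overlaps_sub : overlaps `<=` K.
Proof.
move=> x [k _]; case: unpickle => [[a b]|] //=; case: ifP => // _.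
by move=> [x0 [[su _] _]].
Qed.

Lemma contact_value_unique x v w : K x -> ~ overlaps x ->
  sphere v -> radial M (normalize x) * dot (normalize x) v = supp_fun M v ->
  sphere w -> radial M (normalize x) * dot (normalize x) w = supp_fun M w ->
  f v = f w.
Proof.
move=> Kx Nx; move: v w.
suff le v w : sphere v -> radial M (normalize x) * dot (normalize x) v = supp_fun M v ->
    sphere w -> radial M (normalize x) * dot (normalize x) w = supp_fun M w ->
    f w <= f v.
  by move=> v w sv xv sw xw; apply/eqP; rewrite eq_le !le.
move=> sv xv sw xw; rewrite leNgt; apply/negP => vw; apply: Nx.
have /rat_in_itvoo[a] := vw; rewrite in_itv/= => /andP[va aw].
have /rat_in_itvoo[b] := aw; rewrite in_itv/= => /andP[ab bw].
exists (pickle (a, b)); first by [].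
rewrite pickleK /= -(ltr_rat R) ab.
have [x0 sx] := Kx; split=> //; split; split=> //.
  by exists v; rewrite ?(dotZl (radial M _))//; split => //=; exact: ltW.
by exists w; rewrite ?(dotZl (radial M _))//; split => //=; exact: ltW.
Qed.

Definition contact_value u : R :=
  f (xget u [set v | sphere v /\ radial M u * dot u v = supp_fun M v]).

Lemma contact_valueP u : sphere u -> exists v,
  [/\ sphere v, radial M u * dot u v = supp_fun M v & f v = contact_value u].
Proof.
move=> su; have [_ _ [v sv uv]] := radial_contact cM su.
rewrite /contact_value; case: xgetP => [w _ [sw uw]|/(_ v)]; first by exists w.
by move=> /(_ (conj sv uv)).
Qed.

Lemma contact_valueE x v : (K `\` overlaps) x -> sphere v ->
  radial M (normalize x) * dot (normalize x) v = supp_fun M v ->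
  f v = contact_value (normalize x).
Proof.
move=> [Kx Nx] sv xv; have [w [sw xw <-]] := contact_valueP Kx.2.
exact: contact_value_unique Kx Nx sv xv sw xw.
Qed.

Local Notation K' := (K `\` overlaps).
Local Notation F := (contact_value \o @normalize R n).

Lemma measurable_K' : measurable K'.
Proof. by apply: measurableD; [exact: measurable_cone_sphere|exact: measurable_overlaps]. Qed.

Lemma Rstar_contact_value x (A : set R) : K' x ->
  Rstar M (sphere `&` f @^-1` A) (normalize x) <-> A (F x).
Proof.
move=> K'x; split=> [[sx [v [sv Av]]]|Ax].
  by rewrite (dotZl (radial M _)) => xv /=; rewrite -(contact_valueE K'x sv xv).
have [v [sv xv fv]] := contact_valueP K'x.1.2.
split; first exact: K'x.1.2.
by exists v; rewrite ?(dotZl (radial M _))//; split => //; rewrite /preimage/= fv.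
Qed.

Lemma measurable_contact_value : measurable_fun K' F.
Proof.
move=> mK'; apply: (measurability _ (RGenOInfty.measurableE R)) => //.
move=> /= _ [_ [a ->] <-]; rewrite preimage_itvoy.
have -> : K' `&` [set x | a < F x] =
    K' `\` cone (Rstar M (sphere `&` f @^-1` [set y | y <= a])).
  apply/seteqP; split=> x [K'x].
    by move=> /= ax; split => // -[_ /(Rstar_contact_value _ K'x)/=]; rewrite leNgt ax.
  move=> Nx; split => //=; rewrite ltNge; apply/negP => ax; apply: Nx.
  by split; [exact: K'x.1.1|apply/(Rstar_contact_value _ K'x)].
apply: measurableD => //; apply: measurable_cone.
exact: Rstar_sublevel_measurable.
Qed.

Lemma muE_contact_value (A : set R) : measurable A ->
  mu (sphere `&` f @^-1` A) = (\int[lam]_(x in K' `&` F @^-1` A) (W x)%:E)%E.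
Proof.
move=> mA.
rewrite muE; [|exact: (cont_on_sphere_measurable cf (@measurable_sphere R n))|by move=> v []].
rewrite CtildeE; apply: (integral_null_sandwich (N := overlaps)).
- exact: (measurable_contact_value measurable_K').
- exact: measurable_overlaps.
- exact: overlaps_null.
- by move=> x [K'x Ax]; split; [exact: K'x.1.1|apply/(Rstar_contact_value _ K'x)].
- move=> x [x0 xA]; have [Nx|Nx] := pselect (overlaps x); [by right|left].
  have K'x : K' x by split => //; split => //; case: xA.
  by split => //; apply/(Rstar_contact_value _ K'x).
- apply: measurable_funS (measurable_int _ integrable_weight).
    exact: measurable_cone_sphere.
  by move=> x [[[]]|/overlaps_sub].
- by move=> x; rewrite lee_fin weight_ge0.
Qed.

Lemma integrable_weightK' : lam.-integrable K' (EFin \o W).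
Proof.
apply: integrableS integrable_weight; first exact: measurable_cone_sphere.
  exact: measurable_K'.
by move=> x [].
Qed.

Lemma muE_sphere : mu sphere = (\int[lam]_(x in K') (W x)%:E)%E.
Proof.
have := muE_contact_value (@measurableT _ R).
by rewrite !preimage_setT !setIT.
Qed.

Lemma mu_sphere_lty : (mu sphere < +oo)%E.
Proof. by rewrite muE_sphere; apply: integrable_lty integrable_weightK'; exact: measurable_K'. Qed.

Lemma contact_value_bounded B : (forall v, sphere v -> `|f v| <= B) ->
  forall x, K' x -> `|F x| <= B.
Proof. by move=> fB x [[_ /contact_valueP[v [sv _ fv]]] _] /=; rewrite -fv fB. Qed.

Lemma integrable_contact_value_weight : lam.-integrable K' (fun x => (F x * W x)%:E).
Proof.
have [B B0 fB] := cont_on_sphere_bounded cf.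
have [C C0 wC] := cont_on_sphere_bounded cont_on_sphere_weight.
have mK' := measurable_K'.
apply: (@measurable_bounded_integrable _ _ _ _ (fun x => F x * W x)) => //.
- apply: le_lt_trans (lebesgue_tuple_cone_lty lebl).
  apply: le_measure; rewrite ?inE; [exact: mK'|exact: measurable_cone_sphere|].
  by move=> x [].
- apply: measurable_funM; first exact: measurable_contact_value.
  by apply/measurable_EFinP; exact: measurable_int integrable_weightK'.
- exists (B * C); split; first exact: num_real.
  move=> y By x K'x; apply: le_trans (ltW By); rewrite normrM.
  by apply: ler_pM => //; [exact: contact_value_bounded fB _ K'x|apply: wC; exact: K'x.1.2].
Qed.

Lemma integral_muE :
  (\int[mu]_(v in sphere) (f v)%:E = \int[lam]_(x in K') (F x * W x)%:E)%E.
Proof.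
have [B B0 fB] := cont_on_sphere_bounded cf.
have mS := @measurable_sphere R n; have mK' := measurable_K'.
have mf := cont_on_sphere_measurable cf; have mF := measurable_contact_value.
have mW : measurable_fun K' W.
  by apply/measurable_EFinP; exact: measurable_int integrable_weightK'.
have f0 v : sphere v -> 0 <= f v + B.
  by move=> sv; have := fB v sv; rewrite ler_norml -subr_ge0 opprK => /andP[].
have F0 x : K' x -> 0 <= F x + B.
  move=> K'x; have := contact_value_bounded fB K'x.
  by rewrite ler_norml -subr_ge0 opprK => /andP[].
have mfB : measurable_fun sphere (fun v => f v + B) by exact: measurable_funD.
have mFB : measurable_fun K' (fun x => F x + B) by exact: measurable_funD.
have tr (A : set R) : measurable A ->
    (\int[mu]_(v in sphere `&` (fun v => f v + B)%R @^-1` A) 1%:E =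
     \int[lam]_(x in K' `&` (fun x => F x + B)%R @^-1` A) (W x)%:E)%E.
  move=> mA; rewrite integral_cst ?mul1e; last exact: mfB.
  have mAB : measurable ((fun y : R => y + B) @^-1` A).
    rewrite -[X in measurable X]setTI.
    have : measurable_fun [set: R] (fun y : R => y + B) by exact: measurable_funD.
    by apply.
  exact: muE_contact_value mAB.
have iw := integrable_weightK'.
have W0 x : 0 <= W x by exact: weight_ge0.
have Wfin : (\int[lam]_(x in K') (W x)%:E < +oo)%E by exact: integrable_lty iw.
have fBE : (\int[mu]_(v in sphere) (f v + B)%:E = \int[lam]_(x in K') ((F x + B) * W x)%:E)%E.
  have -> : (\int[mu]_(v in sphere) (f v + B)%:E =
             \int[mu]_(v in sphere) ((f v + B) * 1)%:E)%E.
    by apply: eq_integral => v _; rewrite mulr1.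
  apply/eqP; rewrite eq_le; apply/andP; split.
    exact: (integral_transfer_le_fin mS mK' mfB mFB).
  apply: (integral_transfer_le_fin mK' mS mFB mfB) => //.
    by move=> A mA; rewrite tr.
  by rewrite integral_cst ?mul1e; [exact: mu_sphere_lty|].
have iB : mu.-integrable sphere (EFin \o cst B).
  apply: measurable_bounded_integrable => //; first exact: mu_sphere_lty.
  by exists B; split; [exact: num_real|move=> y By x _ /=; rewrite gtr0_norm// ltW].
have ifS : mu.-integrable sphere (EFin \o f).
  apply: measurable_bounded_integrable => //; first exact: mu_sphere_lty.
  exists B; split; first exact: num_real.
  by move=> y By x sx /=; apply: le_trans (fB x sx) (ltW By).
have iBW : lam.-integrable K' (fun x => (B * W x)%:E).
  have -> : (fun x => (B * W x)%:E) = (fun x => B%:E * (EFin \o W) x)%E by [].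
  exact: integrableZl.
have iFW := integrable_contact_value_weight.
move: fBE.
under eq_integral => v _ do rewrite EFinD.
rewrite (integralD_EFin mS ifS iB).
under [X in _ = X -> _]eq_integral => x _ do rewrite mulrDl EFinD.
rewrite (@integralD_EFin _ _ _ _ _ mK' (fun x => F x * W x) (fun x => B * W x))//.
have -> : (\int[mu]_(x in sphere) (cst B x)%:E = \int[lam]_(x in K') (B * W x)%:E)%E.
  have -> : (fun x => (cst B x)%:E) = cst B%:E :> (T -> \bar R) by [].
  rewrite integral_cst// muE_sphere.
  under [RHS]eq_integral => x _ do rewrite EFinM.
  by rewrite integralZl.
set b := (\int[lam]_(x in K') (B * W x)%:E)%E.
have bfin : b \is a fin_num by exact: integrable_fin_num iBW.
by move/(congr1 (fun z => z - b)%E); rewrite !addeK.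
Qed.

Variables (h : R -> T -> R) (delta : R).
Hypothesis hM : log_wulff_family M f h delta.

Definition perturbed_weight t u :=
  radial (wulff h t) u `^ q * radial Q u `^ (n%:R - q - j).

Lemma integral_K'E (g : T -> R) : cont_on_sphere g ->
  (\int[lam]_(x in K) (g (normalize x))%:E =
   \int[lam]_(x in K') (g (normalize x))%:E)%E.
Proof.
move=> cg; apply: negligible_integral.
- exact: measurable_overlaps.
- exact: measurable_cone_sphere.
- exact: cont_on_sphere_integrable.
- exact: overlaps_null.
Qed.

Lemma integrable_K' (g : T -> R) : cont_on_sphere g ->
  lam.-integrable K' (fun x => (g (normalize x))%:E).
Proof.
move=> cg; apply: integrableS (cont_on_sphere_integrable cg).
- exact: measurable_cone_sphere.
- exact: measurable_K'.
- by move=> x [].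
Qed.

Lemma WtildeE (L : set T) :
  cont_on_sphere (fun u => radial L u `^ q * radial Q u `^ (n%:R - q - j)) ->
  Wtilde lam q j L Q = \int[lam]_(x in K')
    (radial L (normalize x) `^ q * radial Q (normalize x) `^ (n%:R - q - j)).
Proof.
move=> cL; rewrite /Wtilde /sph_int natr_mulVK /Rintegral.
by congr fine; exact: (integral_K'E cL).
Qed.

Lemma cont_on_sphere_perturbed_weight : exists2 d, 0 < d &
  forall t, 0 < `|t| < d -> cont_on_sphere (perturbed_weight t).
Proof.
have [d d0 hd] := radial_family_cont hM; exists d => // t /hd[ct rt].
have /cont_on_sphereP cQ := cont_on_sphere_radialQ_powR.
have /cont_on_sphereP cr : cont_on_sphere (fun u => radial (wulff h t) u `^ q).
  by apply: cont_on_sphere_powR => // u /rt[].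
by apply/cont_on_sphereP => u su; apply: cvgM; [exact: cr|exact: cQ].
Qed.

Lemma Wtilde_deriv :
  (Wtilde lam q j (wulff h t) Q - Wtilde lam q j M Q) / t @[t --> 0^']
    --> q * fine (\int[mu]_(v in sphere) (f v)%:E)%E.
Proof.
have mK' := measurable_K'.
have [d d0 cP] := cont_on_sphere_perturbed_weight.
have [C C0 [d' d'0 bC]] := powR_radial_bound cM cf hM q.
have [B B0 bQ] := cont_on_sphere_bounded cont_on_sphere_radialQ_powR.
apply/cvgr_dnbhsP => t_ [tN0 t0].
have [N _ tN] : \forall k \near \oo, `|t_ k| < Num.min d d'.
  have dd : 0 < Num.min d d' by rewrite lt_min d0.
  by have /cvgrPdist_lt/(_ _ dd) := t0; apply: filterS => k; rewrite sub0r normrN.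
pose s_ k := t_ (k + N)%N.
have s0 : s_ k @[k --> \oo] --> (0 : R).
  by have := t0; rewrite -(cvg_shiftn N).
have sN k : 0 < `|s_ k| < Num.min d d' by rewrite normr_gt0 tN0 tN//= leq_addl.
have sd k : 0 < `|s_ k| < d.
  by have := sN k; rewrite lt_min => /and3P[-> ->].
have sd' k : 0 < `|s_ k| < d'.
  by have := sN k; rewrite lt_min => /and3P[-> _ ->].
rewrite -(cvg_shiftn N).
pose F_ k x := ((perturbed_weight (s_ k) (normalize x) - W x) / s_ k)%:E.
have FE k : (Wtilde lam q j (wulff h (s_ k)) Q - Wtilde lam q j M Q) / s_ k =
    fine (\int[lam]_(x in K') F_ k x)%E.
  rewrite !WtildeE; [|exact: cont_on_sphere_weight|exact: cP (sd k)].
  rewrite -RintegralB//; last 2 first.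
  - exact: integrable_K' (cP _ (sd k)).
  - exact: integrable_K' cont_on_sphere_weight.
  rewrite -RintegralZr//.
  apply: (@integrableB _ _ _ _ _ mK' (fun x => (perturbed_weight (s_ k) (normalize x))%:E) (fun x => (W x)%:E)).
    exact: integrable_K' (cP _ (sd k)).
  exact: integrable_K' cont_on_sphere_weight.
have FkE k x : (perturbed_weight (s_ k) (normalize x) - W x) / s_ k =
    (radial (wulff h (s_ k)) (normalize x) `^ q - radial M (normalize x) `^ q) / s_ k
    * radial Q (normalize x) `^ (n%:R - q - j).
  by rewrite /perturbed_weight /weight /=; ring.
have mF_ k : measurable_fun K' (F_ k).
  apply: measurable_int.
  have -> : F_ k = (fun x => ((s_ k)^-1)%:E * ((fun x => (perturbed_weight (s_ k) (normalize x))%:E) \- (fun x => (W x)%:E)) x)%E.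
    by apply/funext => x; rewrite /F_ mulrC EFinM EFinB.
  apply: integrableZl => //; apply: integrableB => //.
    exact: integrable_K' (cP _ (sd k)).
  exact: integrable_K' cont_on_sphere_weight.
have iF := integrable_contact_value_weight.
have [] := @dominated_convergence _ _ _ lam K' mK' F_
  (fun x => (q * (F x * W x))%:E) (cst (C * B)%:E) mF_ _ _ _ _.
- by apply: measurable_int; exact: (integrableZl mK' q iF).
- apply: aeW => x K'x.
  apply: cvg_EFin; first by apply: nearW.
  rewrite /comp /F_ /=.
  have E : (fun k => (perturbed_weight (s_ k) (normalize x) - W x) / s_ k) =
      (fun k => (radial (wulff h (s_ k)) (normalize x) `^ q - radial M (normalize x) `^ q) / s_ k
    * radial Q (normalize x) `^ (n%:R - q - j)).
    by apply/funext => k; exact: FkE.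
  rewrite E.
  have -> : q * (contact_value (normalize x) * weight (normalize x)) =
      q * (F x * radial M (normalize x) `^ q) * radial Q (normalize x) `^ (n%:R - q - j).
    by rewrite /weight /=; ring.
  apply: cvgMl; apply/cvgrPdist_le => e e0.
  have fF v : sphere v ->
      radial M (normalize x) * dot (normalize x) v = supp_fun M v -> f v = F x.
    exact: contact_valueE K'x.
  have [d2 d20 hd2] := powR_radial_deriv cM cf hM q K'x.1.2 fF e0.
  have /cvgrPdist_lt/(_ _ d20) := s0; apply: filterS => k.
  rewrite sub0r normrN => skd; rewrite distrC; apply: hd2.
  by rewrite skd andbT; case/andP: (sN k).
- apply: measurable_bounded_integrable => //.
    apply: le_lt_trans (lebesgue_tuple_cone_lty lebl).
    apply: le_measure; rewrite ?inE; [exact: mK'|exact: measurable_cone_sphere|].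
    by move=> x [].
  exists (C * B); split; first exact: num_real.
  by move=> y By x _ /=; rewrite gtr0_norm ?mulr_gt0// ltW.
- apply: aeW => x k K'x; rewrite /F_ FkE lee_fin normrM.
  apply: ler_pM => //; first exact: bC (sd' k) _ K'x.1.2.
  exact: bQ K'x.1.2.
move=> _ _.
have -> : (\int[lam]_(x in K') (q * (F x * W x))%:E =
    (q * fine (\int[mu]_(v in sphere) (f v)%:E))%:E)%E.
  under eq_integral => x _ do rewrite EFinM.
  rewrite integralZl// integral_muE EFinM fineK//.
  exact: integrable_fin_num.
move/fine_cvg; apply: cvg_trans; apply: near_eq_cvg; apply: nearW => k /=.
by rewrite -FE.
Qed.

End Curvature_measure.

Theorem theorem4p3 (R : realType) (n : nat)
    (lam : {measure set (n.-tuple R) -> \bar R})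
    (M : set (n.-tuple R)) (f : n.-tuple R -> R) (Q : set (n.-tuple R))
    (q j : R) (h : R -> n.-tuple R -> R) (delta : R)
    (mu : {measure set (n.-tuple R) -> \bar R}) :
  lebesgue_tuple lam ->
  convex_body_o M -> cont_on_sphere f -> star_body_o Q ->
  j != n%:R -> q != 0 ->
  log_wulff_family M f h delta ->
  (* mu is the measure C~_{q,j}(M,Q,.) on the Borel sets of S^{n-1} *)
  (forall eta, measurable eta -> eta `<=` sphere ->
     mu eta = Ctilde lam q j M Q eta) ->
  (Wtilde lam q j (wulff h t) Q - Wtilde lam q j M Q) / t @[t --> 0^']
    --> q * fine (\int[mu]_(v in sphere) (f v)%:E)%E.
Proof.
move=> lebl cM cf sQ _ _ hM muE.
have [n0|n0] := posnP n; last exact: (Wtilde_deriv n0 lebl cM cf sQ muE hM).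
have S0 : @sphere R n = set0.
  apply/seteqP; split=> // u; rewrite /sphere/= /enorm /dot big1 ?sqrtr0.
    by move/esym/eqP; rewrite oner_eq0.
  by move=> [i i_lt] _; exfalso; rewrite n0 in i_lt.
have n10 : (n%:R)^-1 = 0 :> R by rewrite n0 invr0.
have W0 L : Wtilde lam q j L Q = 0 by rewrite /Wtilde n10 mul0e.
rewrite S0 integral_set0 mulr0.
under eq_fun do rewrite !W0 subrr mul0r.
exact: cvg_cst.
Qed.
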